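(* Let $m\ge 1$ and $p\ge 2$ be integers. Consider the moduli space of $pm+1$ points in $\mathbb{P}^{p-1}$ up to projective equivalence. Let $X$ be a variety obtained by twisting this moduli space via permutations of the points, over an infinite field $F$. Then $X$ is rational over $F$.
   Context: The moduli space of $N$ points in $\mathbb{P}^{p-1}$ up to projective equivalence is the quotient of (an open, $\mathfrak{S}_N$-invariant subset of) $(\mathbb{P}^{p-1})^{N}$ by the diagonal action of $\mathrm{PGL}_p$; only its birational class, together with the action of $\mathfrak{S}_N$ permuting the points, matters here. Twisting via permutations means: given a continuous homomorphism $\rho$ from the absolute Galois group of $F$ to $\mathfrak{S}_N$, form the $F$-variety obtained by Galois descent from the moduli space over the separable closure with the Galois action twisted by $\rho$. *)

(* Defs.v *)
From HB Require Import structures.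
From mathcomp Require Import all_boot all_order all_algebra.
From mathcomp Require Import perm separable mpoly.

Set Implicit Arguments.
Unset Strict Implicit.
Unset Printing Implicit Defensive.

Import GRing.Theory.
Local Open Scope ring_scope.
Local Open Scope quotient_scope.

Local Notation "x %:F" := (@FracField.tofrac _ x).

Definition infinite_field (F : fieldType) : Prop :=
  forall s : seq F, exists x : F, x \notin s.

(* [separable_poly q] says that q is coprime to its derivative; in particular
   q is nonzero. *)
Definition separable_closure (F Fs : fieldType) (iota : {rmorphism F -> Fs}) :
    Prop :=
  (forall x : Fs, exists q : {poly F},
     separable_poly q /\ root (map_poly iota q) x) /\
  (forall q : {poly Fs}, separable_poly q -> (1 < size q)%N ->
     exists x : Fs, root q x).

(* When [separable_closure iota] holds, this is the absolute Galois group. *)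
Record gal_aut (F Fs : fieldType) (iota : {rmorphism F -> Fs}) := GalAut {
  gal_mor :> {rmorphism Fs -> Fs};
  gal_bij : bijective gal_mor;
  gal_fix : forall c : F, gal_mor (iota c) = iota c }.

Lemma gal_mul_fix (F Fs : fieldType) (iota : {rmorphism F -> Fs})
    (s t : gal_aut iota) (c : F) : (s \o t) (iota c) = iota c.
Proof. by rewrite /= !gal_fix. Qed.

Definition gal_mul (F Fs : fieldType) (iota : {rmorphism F -> Fs})
    (s t : gal_aut iota) : gal_aut iota :=
  @GalAut F Fs iota (s \o t : {rmorphism Fs -> Fs})
    (bij_comp (gal_bij s) (gal_bij t)) (@gal_mul_fix F Fs iota s t).

(* Permutations are multiplied in [{perm _}] from left to right, so we write
   out the composition of functions: a homomorphism here is a left action of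
   the Galois group on the indices. *)
Definition gal_hom (F Fs : fieldType) (iota : {rmorphism F -> Fs}) (N : nat)
    (rho : gal_aut iota -> 'S_N) : Prop :=
  forall (s t : gal_aut iota) (i : 'I_N), rho (gal_mul s t) i = rho s (rho t i).

(* Continuity for the Krull topology (basic neighbourhoods of s: the
   automorphisms that agree with s on a given finite set) and the discrete
   topology on 'S_N. *)
Definition krull_continuous (F Fs : fieldType) (iota : {rmorphism F -> Fs})
    (N : nat) (rho : gal_aut iota -> 'S_N) : Prop :=
  forall s : gal_aut iota, exists xs : seq Fs, forall t : gal_aut iota,
    {in xs, t =1 s} -> rho t = rho s.

(* The map P / Q |-> h P / h Q on fractions, meaningful for an injective ring
   morphism h; see [frac_mapE]. *)
Definition frac_map (A B : idomainType) (h : A -> B) (f : {fraction A}) :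
    {fraction B} :=
  (h \n_(repr f))%:F / (h \d_(repr f))%:F.

Lemma frac_repr (A : idomainType) (f : {fraction A}) :
  f = (\n_(repr f))%:F / (\d_(repr f))%:F.
Proof.
have d0 := denom_ratioP (repr f).
apply: (canRL (mulfK _)); first by rewrite tofrac_eq0.
rewrite -{1}[f]reprK !piE; apply/eqmodP => /=.
by rewrite FracField.equivfE /FracField.mulf !numden_Ratio
           ?oner_eq0 ?mulr1 // mulrC.
Qed.

Lemma frac_mapE (A B : idomainType) (h : {rmorphism A -> B}) (P Q : A) :
  injective h -> Q != 0 ->
  frac_map h (P%:F / Q%:F) = (h P)%:F / (h Q)%:F.
Proof.
move=> hI Q0; set f := P%:F / Q%:F.
have d0 := denom_ratioP (repr f).
have hn0 a : a != 0 -> (h a)%:F != 0.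
  by rewrite tofrac_eq0 -(rmorph0 h) (inj_eq hI).
have /eqP := frac_repr f; rewrite {1}/f eqr_div ?tofrac_eq0 //.
rewrite -!tofracM tofrac_eq => /eqP E.
by apply/eqP; rewrite eqr_div ?hn0 // -!tofracM -!rmorphM /= -E.
Qed.

Lemma mpoly_rmorph_eq (n : nat) (R S : comNzRingType)
    (h1 h2 : {rmorphism {mpoly R[n]} -> S}) :
  (forall c, h1 c%:MP = h2 c%:MP) -> (forall k, h1 'X_k = h2 'X_k) ->
  h1 =1 h2.
Proof.
move=> hC hX P; rewrite (mpolyE P) !raddf_sum; apply: eq_bigr => mon _ /=.
rewrite -mul_mpolyC !rmorphM /= hC mpolyXE_id !rmorph_prod.
by congr (_ * _); apply: eq_bigr => k _ /=; rewrite !rmorphXn hX.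
Qed.

Section ProductOfProjectiveSpaces.
Variables (K : fieldType) (N p : nat).

(* Homogeneous coordinates of N points in P^(p-1): row i of an N x p matrix
   holds those of the i-th point, and the variable of index
   [mxvec_index i j] is its j-th coordinate. *)
Definition gen_points : 'M[{mpoly K[N * p]}]_(N, p) :=
  \matrix_(i, j) 'X_(mxvec_index i j).

Definition subst_points (f : K -> {mpoly K[N * p]})
    (Y : 'M[{mpoly K[N * p]}]_(N, p)) (P : {mpoly K[N * p]}) :
    {mpoly K[N * p]} :=
  mmap f (fun k => mxvec Y 0 k) P.

Definition multihomog (d : 'I_N -> nat) (P : {mpoly K[N * p]}) : Prop :=
  forall mon, mon \in msupp P ->
    forall i : 'I_N, (\sum_(j < p) mon (mxvec_index i j) = d i)%N.

(* The function field of (P^(p-1))^N. *)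
Definition proj_funfield (f : {fraction {mpoly K[N * p]}}) : Prop :=
  exists (d : 'I_N -> nat) (P Q : {mpoly K[N * p]}),
    [/\ multihomog d P, multihomog d Q, Q != 0 & f = P%:F / Q%:F].

Definition gl_subst (g : 'M[K]_p) : {mpoly K[N * p]} -> {mpoly K[N * p]} :=
  subst_points (@mpolyC _ _) (gen_points *m map_mx (@mpolyC _ _) g).

(* The function field of (P^(p-1))^N / PGL_p, by which the moduli space is
   represented up to birational equivalence. It consists of the rational
   functions invariant under the K-points of GL_p, which act through PGL_p;
   these are dense in GL_p as soon as K is infinite. *)
Definition moduli_funfield (f : {fraction {mpoly K[N * p]}}) : Prop :=
  proj_funfield f /\
  forall g : 'M[K]_p, g \in unitmx -> frac_map (gl_subst g) f = f.

(* The semilinear substitution that applies s to the coefficients and sends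
   the coordinates of the i-th point to those of the (w i)-th point. *)
Definition twist_subst (s : {rmorphism K -> K}) (w : 'S_N) :
    {mpoly K[N * p]} -> {mpoly K[N * p]} :=
  subst_points (@mpolyC _ _ \o s) (row_perm w gen_points).

Lemma gl_subst_zmod g : zmod_morphism (gl_subst g).
Proof. exact: mmap_is_additive. Qed.

Lemma gl_subst_monoid g : monoid_morphism (gl_subst g).
Proof.
pose h k : {mpoly K[N * p]} :=
  mxvec (gen_points *m map_mx (@mpolyC _ _) g) 0 k.
by split=> [|P Q]; [exact: (rmorph1 (mmap (@mpolyC _ _) h))
                   |exact: (rmorphM (mmap (@mpolyC _ _) h))].
Qed.

HB.instance Definition _ g := GRing.isZmodMorphism.Build _ _ (gl_subst g)
  (gl_subst_zmod g).
HB.instance Definition _ g := GRing.isMonoidMorphism.Build _ _ (gl_subst g)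
  (gl_subst_monoid g).

Lemma twist_subst_zmod s w : zmod_morphism (twist_subst s w).
Proof. exact: mmap_is_additive. Qed.

Lemma twist_subst_monoid s w : monoid_morphism (twist_subst s w).
Proof.
pose h k : {mpoly K[N * p]} := mxvec (row_perm w gen_points) 0 k.
by split=> [|P Q]; [exact: (rmorph1 (mmap (@mpolyC _ _ \o s) h))
                   |exact: (rmorphM (mmap (@mpolyC _ _ \o s) h))].
Qed.

HB.instance Definition _ s w := GRing.isZmodMorphism.Build _ _
  (twist_subst s w) (twist_subst_zmod s w).
HB.instance Definition _ s w := GRing.isMonoidMorphism.Build _ _
  (twist_subst s w) (twist_subst_monoid s w).

Lemma gl_substC g c : gl_subst g c%:MP = c%:MP.
Proof. by rewrite /gl_subst /subst_points mmapC. Qed.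

Lemma gl_substX g i j :
  gl_subst g 'X_(mxvec_index i j) =
  \sum_k 'X_(mxvec_index i k) * (g k j)%:MP.
Proof.
rewrite /gl_subst /subst_points mmapX mmap1U mxvecE mxE.
by apply: eq_bigr => k _; rewrite !mxE.
Qed.

Lemma twist_substC (s : {rmorphism K -> K}) w c :
  twist_subst s w c%:MP = (s c)%:MP.
Proof. by rewrite /twist_subst /subst_points mmapC. Qed.

Lemma twist_substX (s : {rmorphism K -> K}) w i j :
  twist_subst s w 'X_(mxvec_index i j) = 'X_(mxvec_index (w i) j).
Proof. by rewrite /twist_subst /subst_points mmapX mmap1U mxvecE !mxE. Qed.

Lemma gl_subst_inj g : g \in unitmx -> injective (gl_subst g).
Proof.
move=> gU; apply: (can_inj (g := gl_subst (invmx g))).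
apply: (mpoly_rmorph_eq (h1 := gl_subst (invmx g) \o gl_subst g) (h2 := idfun)).
  by move=> c /=; rewrite !gl_substC.
move=> k; case/mxvec_indexP: k => i j /=; rewrite gl_substX.
rewrite (raddf_sum (gl_subst (invmx g))) /=.
under eq_bigr => k _ do
  rewrite (rmorphM (gl_subst (invmx g))) /= gl_substX gl_substC mulr_suml.
rewrite exchange_big /=.
have E k : \sum_l invmx g k l * g l j = (k == j)%:R.
  by have /matrixP/(_ k j) := mulVmx gU; rewrite !mxE.
under eq_bigr => k _ do [under eq_bigr => l _ do rewrite -mulrA -mpolyCM;
  rewrite -mulr_sumr -(raddf_sum (@mpolyC _ _)) E].
rewrite (bigD1 j) //= eqxx mulr1 big1 ?addr0 // => k /negPf ->.
by rewrite mpolyC0 mulr0.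
Qed.

Lemma twist_subst_inj (s : {rmorphism K -> K}) w : injective (twist_subst s w).
Proof.
pose t := twist_subst (@idfun K : {rmorphism K -> K}) w^-1.
have E : t \o twist_subst s w =1 map_mpoly s.
  apply: mpoly_rmorph_eq => [c|k] /=.
    by rewrite twist_substC /t twist_substC map_mpolyC.
  case/mxvec_indexP: k => i j.
  by rewrite twist_substX /t twist_substX permK map_mpolyX.
move=> P Q /(congr1 t); rewrite -!/((t \o _) _) !E => /mpolyP PQ.
apply/mpolyP => mon; have := PQ mon.
by rewrite !mcoeff_map_mpoly /= => /fmorph_inj.
Qed.

End ProductOfProjectiveSpaces.

(* The function field of the F-form of the moduli space of N points in
   P^(p-1) obtained by Galois descent for the action twisted by rho: the
   invariants of the twisted semilinear Galois action on the function field
   over Fs. *)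
Definition twisted_moduli_funfield (F Fs : fieldType)
    (iota : {rmorphism F -> Fs}) (N p : nat) (rho : gal_aut iota -> 'S_N)
    (f : {fraction {mpoly Fs[N * p]}}) : Prop :=
  moduli_funfield f /\
  forall s : gal_aut iota, frac_map (twist_subst s (rho s)) f = f.

(* The subfield S of E, an extension of F through j, is F-isomorphic to some
   F(t_1, ..., t_d); for the function field S of an F-variety, this says that
   the variety is rational over F. *)
Definition rational_funfield (F E : fieldType) (j : F -> E) (S : E -> Prop) :
    Prop :=
  exists (d : nat) (phi : {rmorphism {fraction {mpoly F[d]}} -> E}),
    (forall c : F, phi (c%:MP)%:F = j c) /\
    (forall f : E, S f <-> exists g : {fraction {mpoly F[d]}}, f = phi g).

Definition const_frac (F Fs : fieldType) (iota : F -> Fs) (n : nat) (c : F) :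
    {fraction {mpoly Fs[n]}} :=
  ((iota c)%:MP)%:F.

(* Main.v *)
(** Let [N = p m + 1] and let [a_1, ..., a_N] be distinct elements of [Fs] permuted by the
    Galois group as prescribed by [rho]; they exist because [F] is infinite. A count of
    parameters shows that N generic points of P^(p-1) lie, in a unique way, on a
    parametrized rational curve [w] of degree [(p - 1) m] with [w(a_i)] equal to the i-th
    point. So the coefficient matrix [C] of [w], which has [(p - 1) m + 1] rows and [p]
    columns, is determined by the configuration up to a scalar, and rescaling the points
    does not change it. GL_p acts on [C] by right multiplication, so once the rows of the
    exponents [m j], [j < p], are normalized to the identity, the remaining entries [T] of
    [C] are invariant under all the actions considered, the twisted Galois action included,
    and generate the function field. Genericity only has to be tested on the configuration
    [a_i |-> (1, a_i^m, ..., a_i^((p-1)m))], where [T = 0]. *)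
From HB Require Import structures.
Require Import Defs.
From mathcomp Require Import all_boot all_algebra perm separable mpoly ring zify.
From mathcomp Require Import boolp classical_sets.

Set Implicit Arguments.
Unset Strict Implicit.
Unset Printing Implicit Defensive.

Import GRing.Theory.

(** The count behind the curve: [N] scaling factors and [((p - 1) m + 1) p] coefficients make
    [N p + 1] unknowns for [N p] linear equations, one unknown more than equations. The signed
    maximal minors of such a system give a solution that commutes with every ring morphism, so one
    formula serves over the polynomial ring, over its fraction field and at the special
    configuration. The twist disappears from [T] because permuting the points while conjugating the
    [a_i] in the same way only reorders the equations. That invariants are functions of [T] comes
    from evaluating them on normalized configurations; Artin's argument then moves the coefficients
    from [Fs] down to [F]. The converse inclusion needs multihomogeneous fractions to be recognized
    by their invariance under rescaling. Since the Galois group is given only as the automorphisms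
    of [Fs] over [F], the automorphisms that descent requires are built by extending partial
    homomorphisms. *)

(** * Extension of partial homomorphisms of [Fs] over [F] *)

Section SubringGraph.
Local Open Scope ring_scope.
Variables (F Fs : fieldType) (iota : {rmorphism F -> Fs}).
Hypothesis algFs : forall x : Fs, exists q : {poly F},
  separable_poly q /\ root (map_poly iota q) x.

Let Fs2 := (Fs * Fs)%type.
Let diag (c : F) : Fs2 := (iota c, iota c).

Let diag_zmod : zmod_morphism diag.
Proof. by move=> c d; rewrite /diag !rmorphB. Qed.

Let diag_monoid : monoid_morphism diag.
Proof. by split=> [|c d]; rewrite /diag ?rmorph1 ?rmorphM. Qed.

HB.instance Definition _ := GRing.isZmodMorphism.Build F Fs2 diag diag_zmod.
HB.instance Definition _ := GRing.isMonoidMorphism.Build F Fs2 diag diag_monoid.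

(* [G] is the graph of a homomorphism over F from a subring of [Fs] to [Fs]. *)
Definition partial_hom (G : {pred Fs * Fs}) : Prop :=
  [/\ subring_closed G, forall c, (iota c, iota c) \in G &
      forall b, (0, b) \in G -> b = 0].

Section PartialHom.
Variable G : {pred Fs2}.
Hypothesis hG : partial_hom G.

Let hGr : subring_closed G. Proof. by case: hG. Qed.
HB.instance Definition _ := GRing.isSubringClosed.Build Fs2 G hGr.

(** The domain of the homomorphism is a field because [a] is algebraic over [F]: an annihilating
    polynomial stripped of its powers of ['X] has the form [r * 'X + c] with [c != 0], so [a^-1] is
    a polynomial in [a], and the same relation holds for [b]. *)
Lemma partial_homV a b : a != 0 -> (a, b) \in G ->
  b != 0 /\ (a^-1, b^-1) \in G.
Proof.
move=> a0 Gab; have [_ Gc G0] := hG.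
have [q [sq qa]] := algFs a.
have [n [q1 q1n0 Dq]] := multiplicity_XsubC q 0.
have q0 := separable_poly_neq0 sq; rewrite q0 /= in q1n0.
have q1a : root (map_poly iota q1) a.
  move: qa; rewrite Dq rmorphM rmorphXn rmorphB /= map_polyX map_polyC /= rmorph0.
  rewrite rootM; case: n {Dq} => [|n]; first by rewrite expr0 /root hornerC oner_eq0 orbF.
  by rewrite root_exp_XsubC (negPf a0) orbF.
have /factor_theorem [r Dr] : root (q1 - (q1.[0])%:P) 0.
  by rewrite /root !hornerE subrr.
set c := q1.[0] in Dr.
have c0 : c != 0 by move: q1n0; rewrite /root.
pose z : Fs2 := (a, b).
have pG (s : {poly F}) : (map_poly diag s).[z] \in G.
  apply: rpred_horner => //; apply/polyOverP => i; rewrite coef_map; exact: Gc.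
have Dq1 : (map_poly diag q1).[z] = (map_poly diag r).[z] * z + diag c.
  have -> : q1 = r * ('X - 0%:P) + c%:P by rewrite -Dr subrK.
  rewrite rmorphD rmorphM rmorphB /= map_polyX !map_polyC /= rmorph0 !hornerE subr0.
  by rewrite /=.
have H1 (s : {poly F}) : ((map_poly diag s).[z]).1 = (map_poly iota s).[a].
  rewrite -[a]/(fst z) -[LHS]/(fst _) -horner_map -map_poly_comp.
  by congr (_.[_]); apply: eq_map_poly.
have v0 : (map_poly diag q1).[z] = 0.
  have := pG q1; have := H1 q1; move: (map_poly diag q1).[z] => [u v] /=.
  by rewrite (eqP q1a) => -> /G0 ->.
move: Dq1; rewrite v0; have := pG r; move: (map_poly diag r).[z] => [u v] Guv.
move=> [] /esym/eqP; rewrite addr_eq0 => /eqP Ea /esym/eqP; rewrite addr_eq0 => /eqP Eb.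
have ic0 : iota c != 0 by rewrite fmorph_eq0.
have b0 : b != 0.
  by apply: contraNneq ic0 => b0; move: Eb; rewrite b0 mulr0 => /esym/eqP; rewrite oppr_eq0.
split=> //.
suff -> : (a^-1, b^-1) = - (((u, v) : Fs2) * diag c^-1).
  by rewrite rpredN rpredM //; exact: Gc.
by congr (_, _); rewrite /= fmorphV;
   [apply: (mulIf a0)|apply: (mulIf b0)]; rewrite mulVf //
   mulNr mulrAC ?Ea ?Eb mulNr opprK divff.
Qed.

(** [Fs * Fs] has zero divisors, so the division is carried out by a monic divisor, with the
    quotient and the remainder kept over [G]. *)
Lemma polyOver_div (D A : {poly Fs2}) : D \is monic -> D \is a polyOver G ->
  A \is a polyOver G -> exists B R : {poly Fs2},
  [/\ B \is a polyOver G, R \is a polyOver G, A = B * D + R & (size R < size D)%N].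
Proof.
move=> mD GD; have [n] := ubnP (size A); elim: n A => // n IHn A.
rewrite ltnS => leAn GA; have [ltAD|leDA] := ltnP (size A) (size D).
  by exists 0, A; rewrite mul0r add0r rpred0.
pose M : {poly Fs2} := (lead_coef A)%:P * 'X^(size A - size D).
have GM : M \is a polyOver G.
  by rewrite rpredM ?polyOverC ?polyOverXn // lead_coefE (polyOverP GA).
have [d Ed] : exists d, size D = d.+1.
  by exists (size D).-1; rewrite prednK // size_poly_gt0 monic_neq0.
have [k Ek] : exists k, size A = (k + d.+1)%N.
  by exists (size A - size D)%N; rewrite -Ed subnK.
have lD : D`_d = 1 by rewrite -(monicP mD) lead_coefE Ed.
have [] := IHn (A - M * D).
- rewrite (leq_trans _ leAn) // Ek addnS ltnS.
  apply/leq_sizeP => j lej; rewrite coefB -mulrA coefCM coefXnM Ek Ed addnK.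
  rewrite ltnNge (leq_trans (leq_addr _ _) lej) /=.
  move: lej; rewrite leq_eqVlt => /predU1P[<-|ltj].
    by rewrite addKn lD mulr1 lead_coefE Ek addnS subrr.
  rewrite !nth_default ?mulr0 ?subrr // ?Ek ?Ed ?addnS //.
  by rewrite ltn_subRL.
- by rewrite rpredB // rpredM.
move=> B [R [GB GR E ltR]]; exists (M + B), R; split=> //; first by rewrite rpredD.
by rewrite mulrDl -addrA -E addrC subrK.
Qed.

(** [D] pairs the minimal polynomial of [x] over the domain of [G] with its image under the
    homomorphism; the roots of the image are the possible values at [x]. The image divides a
    separable polynomial over [F], which the homomorphism fixes. *)
Lemma partial_hom_extend x : exists D : {poly Fs2},
  [/\ forall i, D`_i \in G, D \is monic, root (map_poly fst D) x,
      separable_poly (map_poly snd D) &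
      forall y, root (map_poly snd D) y -> exists G' : {pred Fs2},
        [/\ partial_hom G', {subset G <= G'} & (x, y) \in G']].
Proof.
have [_ Gc G0] := hG.
pose ann n := exists2 A : {poly Fs2}, A \is a polyOver G &
  [/\ A != 0, root (map_poly fst A) x & size A = n].
have [q [sq qx]] := algFs x.
pose C := map_poly diag q.
have GC : C \is a polyOver G by apply/polyOverP => i; rewrite coef_map; exact: Gc.
have C1 : map_poly fst C = map_poly iota q by rewrite -map_poly_comp; exact: eq_map_poly.
have C2 : map_poly snd C = map_poly iota q by rewrite -map_poly_comp; exact: eq_map_poly.
have C0 : C != 0.
  apply: contraTneq (separable_poly_neq0 sq) => C0.
  by rewrite -(map_poly_eq0 iota) -C1 C0 rmorph0 eqxx.
have exn : exists n, `[< ann n >].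
  by exists (size C); apply/asboolP; exists C => //; split; rewrite ?C1.
case: (ex_minnP exn) => n /asboolP [A GA [A0 Ax sA]] min_n.
have := lead_coef_eq0 A; rewrite (negPf A0) => /negbT.
have : lead_coef A \in G by rewrite lead_coefE (polyOverP GA).
case E : (lead_coef A) => [a b] Gab nz.
have a0 : a != 0 by apply: contraNneq nz => a0; move: Gab; rewrite a0 => /G0 ->.
have [b0 Gv] := partial_homV a0 Gab.
pose v : Fs2 := (a^-1, b^-1); pose D := v%:P * A.
have GD : D \is a polyOver G by rewrite rpredM ?polyOverC.
have vE : v * lead_coef A = 1 by rewrite E; congr (_, _); rewrite /= mulVf.
have cD : D`_(size A).-1 = 1 by rewrite coefCM -lead_coefE vE.
have sD : size D = n.
  apply/eqP; rewrite eqn_leq /D mul_polyC -{1}sA size_scale_leq -mul_polyC -/D.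
  rewrite -sA -(prednK (n := size A)) ?size_poly_gt0 // ltnNge.
  by apply: contra_eqN cD => leD; rewrite nth_default // eq_sym oner_eq0.
have mD : D \is monic.
  by rewrite monicE lead_coefE sD -sA cD.
have Dx : root (map_poly fst D) x by rewrite rmorphM rootM Ax orbT.
clearbody D.
have dvd B : B \is a polyOver G -> root (map_poly fst B) x ->
    exists2 Q, Q \is a polyOver G & B = Q * D.
  move=> GB Bx; have [Q [R [GQ GR EB ltR]]] := polyOver_div mD GD GB.
  exists Q => //; rewrite EB; have [->|R0] := eqVneq R 0; first by rewrite addr0.
  have : root (map_poly fst R) x.
    by move: Bx; rewrite EB rmorphD rmorphM /root !hornerE (eqP Dx) mulr0 add0r.
  move=> Rx; suff : (n <= size R)%N by rewrite leqNgt -sD ltR.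
  by apply/min_n/asboolP; exists R.
exists D; split=> //; first exact/polyOverP.
  have [|Q _ EC] := dvd C GC; first by rewrite C1.
  apply: (@dvdp_separable _ (map_poly iota q)); last by rewrite separable_map.
  by rewrite -C2 EC rmorphM dvdp_mull.
move=> y Dy; pose z0 : Fs2 := (x, y).
(* The graph of the extension is [G[(x, y)]]. It is single-valued because a polynomial over [G]
   whose first component kills [x] is a multiple of [D], and [D] vanishes at [(x, y)]. *)
pose G' : {pred Fs2} := fun z => `[< exists2 B : {poly Fs2}, B \is a polyOver G & z = B.[z0] >].
have G'P z : reflect (exists2 B : {poly Fs2}, B \is a polyOver G & z = B.[z0]) (z \in G').
  exact: asboolP.
exists G'.
have fstE (B : {poly Fs2}) : (B.[z0]).1 = (map_poly fst B).[x].
  by rewrite -[x in RHS]/(fst z0) horner_map.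
have sndE (B : {poly Fs2}) : (B.[z0]).2 = (map_poly snd B).[y].
  by rewrite -[y in RHS]/(snd z0) horner_map.
split.
- split.
  + split.
    * by apply/G'P; exists 1; rewrite ?rpred1 // hornerC.
    * move=> _ _ /G'P [B GB ->] /G'P [B' GB' ->].
      by apply/G'P; exists (B - B'); rewrite ?rpredB // !hornerE.
    * move=> _ _ /G'P [B GB ->] /G'P [B' GB' ->].
      by apply/G'P; exists (B * B'); rewrite ?rpredM // hornerM.
  + move=> c; apply/G'P; exists (diag c)%:P; rewrite ?hornerC // polyOverC.
    exact: Gc.
  + move=> b' /G'P [B GB EB].
    have [|Q _ EQ] := dvd B GB; first by rewrite /root -fstE -EB.
    by rewrite -[b']/(0 : Fs, b').2 EB sndE EQ rmorphM /= hornerM (eqP Dy) mulr0.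
- by move=> z Gz; apply/G'P; exists (z : Fs2)%:P; rewrite ?hornerC // polyOverC.
- by apply/G'P; exists 'X; rewrite ?hornerX // polyOverX.
Qed.

End PartialHom.

Lemma partial_hom_total (G : {pred Fs * Fs}) :
  (forall q : {poly Fs}, separable_poly q -> (1 < size q)%N ->
     exists x : Fs, root q x) ->
  partial_hom G -> exists G' : {pred Fs * Fs},
  [/\ partial_hom G', {subset G <= G'} & forall x, exists y, (x, y) \in G'].
Proof.
move=> sepclosed hG.
(* Zorn's lemma also asks for the union of the empty chain; testing the union of [S] with [G]
   instead of [S] makes the empty set admissible. *)
pose ext (S : set Fs2) : {pred Fs2} := fun z => (z \in G) || `[< S z >].
have Gext S : {subset G <= ext S} by move=> z Gz; rewrite unfold_in Gz.
have [|S [hS maxS]] := @Zorn_bigcup Fs2 (fun S => partial_hom (ext S)).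
  move=> C CP totC; set U := ext _.
  have sub2 u v : u \in U -> v \in U -> exists H : {pred Fs2},
      [/\ partial_hom H, {subset H <= U}, u \in H & v \in H].
    have CU X : C X -> {subset ext X <= U}.
      move=> CX z /orP[Gz|/asboolP Xz]; first exact: Gext.
      by apply/orP; right; apply/asboolP; exists X.
    have inC z : z \in U -> z \in G \/ exists2 X, C X & X z.
      by case/orP=> [|/asboolP [X CX Xz]]; [left|right; exists X].
    move=> /inC Uu /inC Uv.
    have GU : {subset G <= U} by apply: Gext.
    have inX (X : set Fs2) z : X z -> z \in ext X by move=> Xz; apply/orP; right; apply/asboolP.
    case: Uu Uv => [Gu|[X CX Xu]] [Gv|[Y CY Yv]].
    - by exists G.
    - by exists (ext Y); split; [exact: CP|exact: CU|exact: Gext|exact: inX].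
    - by exists (ext X); split; [exact: CP|exact: CU|exact: inX|exact: Gext].
    have [XY|YX] := totC _ _ CX CY.
      by exists (ext Y); split; [exact: CP|exact: CU|apply: inX; exact: XY|exact: inX].
    by exists (ext X); split; [exact: CP|exact: CU|exact: inX|apply: inX; exact: YX].
  have [_ Gc _] := hG.
  split; first split.
  - by rewrite -[1]/((1, 1) : Fs2) -(rmorph1 iota); apply: Gext.
  - by move=> u v /sub2 H /H [H' [[[_ HB _] _ _] HU Hu Hv]]; apply/HU/HB.
  - by move=> u v /sub2 H /H [H' [[[_ _ HM] _ _] HU Hu Hv]]; apply/HU/HM.
  - by move=> c; apply: Gext.
  - by move=> b Ub; have [H [[_ _ H0] _ Hb _]] := sub2 _ _ Ub Ub; apply: H0.
exists (ext S); split=> // x.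
have [D [_ mD Dx sD extD]] := partial_hom_extend hS x.
have sizeD1 : (1 < size (map_poly snd D))%N.
  have mD1 : map_poly fst D \is monic by apply: monic_map.
  have mD2 : map_poly snd D \is monic by apply: monic_map.
  have -> : size (map_poly snd D) = size (map_poly fst D).
    by rewrite !size_map_poly_id0 // (monicP mD) oner_eq0.
  exact: root_size_gt1 (monic_neq0 mD1) Dx.
have [y Dy] := sepclosed _ sD sizeD1.
have [G' [hG' sG' xyG']] := extD y Dy.
exists y; pose S' : set Fs2 := [set z | z \in G']%classic.
have extS' : ext S' = G'.
  apply: funext => z; rewrite /ext /=; apply/orP/idP => [[Gz|/asboolP //]|G'z].
    by apply/sG'/Gext.
  by right; apply/asboolP.
apply: contrapT => nxy; apply: (maxS S'); last by rewrite extS'.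
split=> [z Sz|/(_ (x, y)) SS']; first by apply: sG'; apply/orP; right; apply/asboolP.
by apply: nxy; apply/orP; right; apply/asboolP/SS'.
Qed.

End SubringGraph.

(** * The Galois group of [Fs] over [F] *)

Lemma idfun_bij (K : fieldType) : bijective (@idfun K : {rmorphism K -> K}).
Proof. by exists id. Qed.

Definition gal_one (F Fs : fieldType) (iota : {rmorphism F -> Fs}) : gal_aut iota :=
  @GalAut F Fs iota _ (idfun_bij Fs) (fun c => erefl).

Section GaloisTheory.
Local Open Scope ring_scope.
Variables (F Fs : fieldType) (iota : {rmorphism F -> Fs}).
Hypothesis hFs : separable_closure iota.

Lemma gal_aut_of_partial_hom (G : {pred Fs * Fs}) : partial_hom iota G ->
  (forall x, exists y, (x, y) \in G) ->
  exists s : gal_aut iota, forall x y, (x, y) \in G -> s x = y.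
Proof.
move=> [[_ GB GM] Gc G0] /choice [f Gf].
have fE x y : (x, y) \in G -> f x = y.
  move=> Gxy; apply/eqP; rewrite -subr_eq0; apply/eqP/G0.
  rewrite -[X in (X, _)](subrr x); exact: (GB _ _ (Gf x) Gxy).
have fc c : f (iota c) = iota c by apply/fE/Gc.
have fB : zmod_morphism f by move=> x y; apply/fE/(GB (x, _) (y, _)).
have fM : monoid_morphism f.
  by split=> [|x y]; [rewrite -(rmorph1 iota)|apply/fE/(GM (x, _) (y, _))].
pose h : {rmorphism Fs -> Fs} := HB.pack f
  (GRing.isZmodMorphism.Build _ _ f fB) (GRing.isMonoidMorphism.Build _ _ f fM).
have hI : injective h by apply: fmorph_inj.
suff hbij : bijective h by exists (@GalAut _ _ _ h hbij fc).
have surj y : exists x, h x = y.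
  have [q [sq qy]] := hFs.1 y.
  have q0 : map_poly iota q != 0 by rewrite map_poly_eq0 separable_poly_neq0.
  (* [h] permutes the finitely many roots of [q]. *)
  have step x : root (map_poly iota q) x -> root (map_poly iota q) (h x).
    move=> qx; rewrite /root; have -> : map_poly iota q = map_poly h (map_poly iota q).
      by rewrite -map_poly_comp; apply: eq_map_poly => c /=; rewrite fc.
    by rewrite horner_map (eqP qx) rmorph0.
  have [//|nex] := EM (exists x, h x = y).
  have it n : root (map_poly iota q) (iter n h y) by elim: n => //= n; apply: step.
  (* Were [y] outside the image, injectivity of [h] would make its iterates pairwise distinct, too
     many roots for [q]. *)
  have inj_it : injective (fun n => iter n h y).
    have aux a b : iter a h y = iter (b + a) h y -> b = 0%N.
      elim: a => [|a IHa]; last by rewrite addnS => /hI /IHa.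
      by case: b => // b E; case: nex; exists (iter b h y); rewrite [RHS]E addn0.
    move=> a b E; have [le|/ltnW le] := leqP a b; move: E; rewrite -(subnK le).
      by move/aux->.
    by move/esym/aux->.
  have := @max_poly_roots _ (map_poly iota q)
    (mkseq (fun n => iter n h y) (size (map_poly iota q))) q0.
  rewrite size_mkseq ltnn mkseq_uniq //; move=> H; case: notF; apply: H => //.
  by apply/allP => _ /mapP [n _ ->].
have [g hg] := choice surj.
by exists g => // x; apply: hI; rewrite hg.
Qed.

(** If the minimal polynomial [D] of [z] over [F] had degree above 1, separability would give it a
    root [y != z], and some automorphism would send [z] to [y]. *)
Lemma gal_fixed_field z : (forall s : gal_aut iota, s z = z) ->
  exists c, z = iota c.
Proof.
move=> fix_z; have [algFs sepclosed] := hFs.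
pose G0 : {pred Fs * Fs} := fun w => `[< exists c, w = (iota c, iota c) >].
have G0P w : reflect (exists c, w = (iota c, iota c)) (w \in G0) by apply: asboolP.
have hG0 : partial_hom iota G0.
  split; first split.
  - by apply/G0P; exists 1; rewrite !rmorph1.
  - by move=> _ _ /G0P [c ->] /G0P [d ->]; apply/G0P; exists (c - d); rewrite !rmorphB.
  - by move=> _ _ /G0P [c ->] /G0P [d ->]; apply/G0P; exists (c * d); rewrite !rmorphM.
  - by move=> c; apply/G0P; exists c.
  - by move=> b /G0P [c [c0 ->]].
have [D [GD mD Dz sD extD]] := partial_hom_extend algFs hG0 z.
have E12 : map_poly fst D = map_poly snd D.
  apply/polyP => i; rewrite !coef_map /=.
  by have /G0P [c ->] := GD i.
have mD2 : map_poly snd D \is monic by apply: monic_map.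
rewrite E12 in Dz; have sgt1 := root_size_gt1 (monic_neq0 mD2) Dz.
have /factor_theorem [r Dr] := Dz.
have [le2|] := ltnP 1 (size r).
  have sr : separable_poly r by apply: dvdp_separable sD; rewrite Dr dvdp_mulr.
  have [y ry] := sepclosed r sr le2.
  have zy : y != z.
    by move: sD; rewrite Dr separable_root => /andP [_]; apply: contraNneq => <-.
  have [|G1 [hG1 sG1 G1zy]] := extD y; first by rewrite Dr rootM ry.
  have [G2 [hG2 sG2 tot2]] := partial_hom_total algFs sepclosed hG1.
  have [s sE] := gal_aut_of_partial_hom hG2 tot2.
  by move: zy; rewrite -(sE z y) ?fix_z ?eqxx //; apply: sG2.
have mr : r \is monic by move: mD2; rewrite Dr monicMr ?monicXsubC.
move=> /size1_polyC Er.
have r1 : r = 1 by move: mr; rewrite Er monicE lead_coefC => /eqP ->.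
have /G0P [c Dc] := GD 0%N.
exists (- c); rewrite rmorphN.
have : (map_poly snd D)`_0 = iota c by rewrite coef_map Dc.
by rewrite Dr r1 mul1r coefB coefX coefC sub0r => <-; rewrite opprK.
Qed.

Lemma gal_map_poly (s : gal_aut iota) (q : {poly F}) :
  map_poly s (map_poly iota q) = map_poly iota q.
Proof. by rewrite -map_poly_comp; apply: eq_map_poly => c /=; rewrite gal_fix. Qed.

Lemma gal_root (s : gal_aut iota) (q : {poly F}) x :
  root (map_poly iota q) x -> root (map_poly iota q) (s x).
Proof. by move=> qx; rewrite /root -(gal_map_poly s) horner_map (eqP qx) rmorph0. Qed.

Lemma gal_inv (s : gal_aut iota) : exists t : gal_aut iota, cancel s t /\ cancel t s.
Proof.
have [f sK fK] := gal_bij s.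
have fc c : f (iota c) = iota c by rewrite -{1}(gal_fix s) sK.
pose h : {rmorphism Fs -> Fs} := HB.pack f
  (GRing.isZmodMorphism.Build _ _ f (can2_zmod_morphism sK fK))
  (GRing.isMonoidMorphism.Build _ _ f (can2_monoid_morphism sK fK)).
have hbij : bijective h by exists s.
by exists (@GalAut _ _ _ h hbij fc).
Qed.

(** * Infinite base fields and equivariant points *)

Section InfiniteField.
Hypothesis hF : infinite_field F.

Lemma infinite_uniq_seq n : exists2 s : seq F, uniq s & size s = n.
Proof.
elim: n => [|n [s us <-]]; first by exists [::].
by have [x xs] := hF s; exists (x :: s); rewrite //= xs.
Qed.

Lemma infinite_nonroot (K : fieldType) (j : {rmorphism F -> K}) (P : {poly K}) :
  P != 0 -> exists c, ~~ root P (j c).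
Proof.
move=> P0; have [s us ss] := infinite_uniq_seq (size P).
have [[c _ Pc]|nroot] := EM (exists2 c, c \in s & ~~ root P (j c)); first by exists c.
have := max_poly_roots (rs := map j s) P0.
rewrite size_map ss ltnn map_inj_uniq; last exact: fmorph_inj.
rewrite us; move=> H; case: notF; apply: H => //; apply/allP => _ /mapP [c cs ->].
by apply/negPn/negP => Pc; apply: nroot; exists c.
Qed.

(** The primitive element theorem, in the form used with continuity: for a suitable [c], both [x]
    and [y] are polynomials over [F] in [iota c * y - x]. *)
Lemma gal_primitive (xs : seq Fs) :
  exists e, forall s t : gal_aut iota, s e = t e -> {in xs, s =1 t}.
Proof.
elim: xs => [|x xs [y IHy]]; first by exists 0.
have [p [sp px]] := hFs.1 x; have [q [sq qy]] := hFs.1 y.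
have [r r0 rP] := large_field_PET (separable_poly_neq0 sp) px qy sq.
have [c rc] := infinite_nonroot iota r0.
have [[u ux] [v vy]] := rP c rc.
set z := iota c * y - x in ux vy; exists z => s t stz.
have sE (w : {poly F}) : s (map_poly iota w).[z] = t (map_poly iota w).[z].
  by rewrite -!horner_map !gal_map_poly stz.
move=> w; rewrite inE => /predU1P [->|]; first by rewrite -ux sE.
by apply: IHy; rewrite -vy sE.
Qed.

(** A vector space over an infinite field is not a finite union of proper subspaces. Here [W] is
    only an [F]-subspace of an [Fs]-space, hence the scalars [iota c]. *)
Lemma avoid_zeros (V : lmodType Fs) (W : V -> Prop) (I : finType)
    (l : I -> V -> Fs) : W 0 ->
  (forall c v w, W v -> W w -> W (v + iota c *: w)) ->
  (forall i c v w, l i (v + iota c *: w) = l i v + iota c * l i w) ->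
  (forall i, exists2 v, W v & l i v != 0) ->
  exists2 v, W v & forall i, l i v != 0.
Proof.
move=> W0 WD lD lW.
suff [v Wv lv] : exists2 v, W v & forall i, i \in enum I -> l i v != 0.
  by exists v => // i; apply: lv; rewrite mem_enum.
elim: (enum I) => [|i s [v Wv lv]]; first by exists 0.
have [w Ww lw] := lW i.
pose P (k : I) : {poly Fs} := (l k v)%:P + (l k w)%:P * 'X.
have PE k c : (P k).[iota c] = l k (v + iota c *: w).
  by rewrite /P !hornerE lD mulrC.
have P0 k : k \in i :: s -> P k != 0.
  move=> ks; apply/eqP => Pk.
  have c0 : l k v = 0 by rewrite -(coef0 _ 0) -Pk !coefE mulr0 addr0.
  have c1 : l k w = 0 by rewrite -(coef0 _ 1) -Pk !coefE mulr1 add0r.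
  move: ks; rewrite inE => /predU1P [Ek|/lv]; last by rewrite c0 eqxx.
  by move: lw; rewrite -Ek c1 eqxx.
have [|c Pc] := infinite_nonroot iota (P := \prod_(k <- i :: s) P k).
  by rewrite prodf_seq_neq0; apply/allP => k /P0.
exists (v + iota c *: w) => [|k ks]; first exact: WD.
apply: contra Pc; rewrite -PE => Pk; rewrite /root horner_prod prodf_seq_eq0.
by apply/hasP; exists k.
Qed.

Section Equivariant.
Variables (N : nat) (rho : gal_aut iota -> 'S_N).
Hypotheses (hrho : gal_hom rho) (crho : krull_continuous rho).

(** Automorphisms equal as functions may differ as records; continuity identifies their images.
    Applied to [s] and [gal_mul s s], it makes [rho s] idempotent. *)
Lemma gal_hom_id (s : gal_aut iota) : s =1 id -> rho s = 1%g.
Proof.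
move=> s1; apply/permP => i; rewrite perm1; apply: (@perm_inj _ (rho s)).
rewrite -hrho; have [xs cxs] := crho s.
by rewrite (cxs (gal_mul s s)) // => x _ /=; rewrite !s1.
Qed.

(** If [s e = t e], the inverse of [s] composed with [t] fixes [e], hence the finite set that
    continuity at the identity provides, so [rho] cannot tell it from the identity. *)
Lemma gal_hom_stab : exists e, forall s t : gal_aut iota, s e = t e -> rho s = rho t.
Proof.
pose one := gal_one iota.
have [xs cxs] := crho one; have [e eP] := gal_primitive xs.
exists e => s t est; have [s' [sK s'K]] := gal_inv s.
have E1 : rho (gal_mul s' t) = rho one.
  by apply: cxs; apply: eP; rewrite /= -est sK.
have E2 : rho (gal_mul s' s) = rho one by apply: cxs => x _ /=; rewrite sK.
apply/permP => i; apply: (@perm_inj _ (rho s')).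
by rewrite -!hrho E1 E2.
Qed.

(** Since [rho s] depends only on [s e], the conjugates of [e] are labelled by permutations, [r]
    below. Polynomials with prescribed conjugates as roots, evaluated at points of [F], give
    equivariant vectors; combining these separates all pairs of indices at once. *)
Lemma equivariant_points : exists a : 'I_N -> Fs,
  injective a /\ forall (s : gal_aut iota) i, s (a i) = a (rho s i).
Proof.
have [e eP] := gal_hom_stab.
pose one := gal_one iota.
have [q [sq qe]] := hFs.1 e.
pose conj y := exists s : gal_aut iota, s e = y.
have conj_root y : conj y -> root (map_poly iota q) y.
  by move=> [s <-]; apply: gal_root.
have [O uO OP] : exists2 O : seq Fs, uniq O & forall y, y \in O <-> conj y.
  (* A largest finite set of conjugates is the whole orbit; the roots of [q] bound its size. *)
  pose ann n := `[< exists2 O : seq Fs, uniq O /\ (forall y, y \in O -> conj y) & size O = n >].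
  have ex0 : exists n, ann n by exists 0%N; apply/asboolP; exists [::].
  have bound n : ann n -> (n <= size (map_poly iota q))%N.
    move=> /asboolP [O [uO OC] <-]; apply/ltnW/max_poly_roots => //.
      by rewrite map_poly_eq0 separable_poly_neq0.
    by apply/allP => y /OC/conj_root.
  case: (ex_maxnP ex0 bound) => n /asboolP [O [uO OC] sO] maxn.
  exists O => // y; split=> [/OC //|Cy]; apply: contrapT => /negP nOy.
  have := maxn n.+1; rewrite ltnn; move=> H; apply: notF; apply: H.
  apply/asboolP; exists (y :: O); rewrite /= ?sO // nOy; split=> // z.
  by rewrite inE => /predU1P [->|/OC].
have [g gP] : exists g : Fs -> gal_aut iota, forall y, conj y -> g y e = y.
  suff /choice [g gP] : forall y, exists t : gal_aut iota, conj y -> t e = y by exists g.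
  move=> y; by have [[s sy]|nC] := EM (conj y); [exists s|exists one].
pose r y := rho (g y).
have rE (s : gal_aut iota) : r (s e) = rho s by apply: eP; apply: gP; exists s.
(* The roots of [P k i] are the conjugates whose label sends [k] to [i]; applying [s] composes the
   labels with [rho s], so it turns [i] into [rho s i]. *)
pose P k i : {poly Fs} := \prod_(y <- O | r y k == i) ('X - y%:P).
have PE k (s : gal_aut iota) i : map_poly s (P k i) = P k (rho s i).
  rewrite rmorph_prod /=.
  have pO : perm_eq [seq s y | y <- O] O.
    have us : uniq [seq s y | y <- O] by rewrite map_inj_uniq //; apply: fmorph_inj.
    have sO : {subset [seq s y | y <- O] <= O}; last first.
      by apply: uniq_perm => //; apply: (uniq_min_size us sO _).2; rewrite size_map.
    by move=> _ /mapP [y /OP [t <-] ->]; apply/OP; exists (gal_mul s t).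
  rewrite /P -[RHS](perm_big _ pO) big_map /= big_seq_cond [RHS]big_seq_cond.
  apply: eq_big => [y|y _]; last by rewrite rmorphB /= map_polyX map_polyC.
  apply: andb_id2l => /OP [t <-].
  by rewrite -[s (t e)]/(gal_mul s t e) !rE hrho (inj_eq perm_inj).
pose W (v : 'rV[Fs]_N) := forall (s : gal_aut iota) i, s (v 0 i) = v 0 (rho s i).
pose I : finType := {x : 'I_N * 'I_N | x.1 != x.2}.
pose l (x : I) (v : 'rV[Fs]_N) := v 0 (val x).1 - v 0 (val x).2.
have [||||v Wv lv] := @avoid_zeros 'rV[Fs]_N W I l.
- by move=> s i; rewrite !mxE rmorph0.
- by move=> c v w Wv Ww s i; rewrite !mxE rmorphD rmorphM /= Wv Ww gal_fix.
- by move=> x c v w; rewrite /l !mxE; ring.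
- case=> -[i j] /= ij; rewrite /l /=.
  (* The label of [e] is the identity, so [e] is a root of [P i i] but not of [P i j]. *)
  have Pij : P i i - P i j != 0.
    rewrite subr_eq0; apply/eqP => /(congr1 (root^~ e)).
    have eO : e \in O by apply/OP; exists one.
    have re : r e = 1%g by rewrite -[e]/(one e) rE gal_hom_id.
    have rootP k : root (P i k) e = (i == k).
      rewrite /root horner_prod prodf_seq_eq0 -[i in RHS](perm1 i) -re.
      apply/hasP/idP => [[y _]|rk]; last by exists e; rewrite // rk !hornerE subrr eqxx.
      by rewrite !hornerE subr_eq0 => /andP [rk /eqP ->].
    by rewrite !rootP eqxx (negPf ij).
  have [c] := infinite_nonroot iota Pij; rewrite /root !hornerE => Pc.
  exists (\row_k (P i k).[iota c]); last by rewrite !mxE.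
  by move=> s k; rewrite !mxE -PE -(gal_fix s c) horner_map gal_fix.
exists (v 0); split=> // i j vij; apply/eqP; apply/negP => /negP ij.
have := lv (exist _ (i, j) ij); rewrite /l /= vij subrr eqxx //.
Qed.

End Equivariant.
End InfiniteField.
End GaloisTheory.

(** * Morphisms of fraction fields *)

Section FractionMorphisms.
Local Open Scope ring_scope.
Local Notation "x %:F" := (@FracField.tofrac _ x).

Lemma fracP (A : idomainType) (f : {fraction A}) :
  exists P Q : A, Q != 0 /\ f = P%:F / Q%:F.
Proof.
exists \n_(repr f), \d_(repr f); split; first exact: denom_ratioP.
exact: frac_repr.
Qed.

Lemma frac_lift (A : idomainType) (K : fieldType) (h : {rmorphism A -> K}) :
  injective h -> exists phi : {rmorphism {fraction A} -> K}, forall P Q,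
    Q != 0 -> phi (P%:F / Q%:F) = h P / h Q.
Proof.
move=> hI; pose phi (f : {fraction A}) := h \n_(repr f) / h \d_(repr f).
have h0 Q : Q != 0 -> h Q != 0 by rewrite -(rmorph0 h) (inj_eq hI).
have F0 (Q : A) : Q != 0 -> Q%:F != 0 by rewrite tofrac_eq0.
have phiE P Q : Q != 0 -> phi (P%:F / Q%:F) = h P / h Q.
  move=> Q0; rewrite /phi; set f := P%:F / Q%:F.
  have d0 := denom_ratioP (repr f).
  apply/eqP; rewrite eqr_div ?h0 // -!rmorphM (inj_eq hI) -tofrac_eq !tofracM.
  by rewrite -eqr_div ?F0 // -frac_repr.
have phi1 P : phi P%:F = h P.
  by rewrite -[P%:F]divr1 -tofrac1 phiE ?oner_eq0 // rmorph1 divr1.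
have phiB : zmod_morphism phi.
  move=> f g; have [P [Q [Q0 ->]]] := fracP f; have [R [S [S0 ->]]] := fracP g.
  rewrite -mulNr addf_div ?F0 // -!tofracN -!tofracM -tofracD !phiE ?mulf_neq0 //.
  by rewrite rmorphD !rmorphM rmorphN -addf_div ?h0 // mulNr.
have phiM : monoid_morphism phi.
  split=> [|f g]; first by rewrite -tofrac1 phi1 rmorph1.
  have [P [Q [Q0 ->]]] := fracP f; have [R [S [S0 ->]]] := fracP g.
  by rewrite mulf_div -!tofracM !phiE ?mulf_neq0 // !rmorphM mulf_div.
pose phi' : {rmorphism {fraction A} -> K} := HB.pack phi
  (GRing.isZmodMorphism.Build _ _ phi phiB) (GRing.isMonoidMorphism.Build _ _ phi phiM).
by exists phi'.
Qed.

Lemma frac_map_rmorph (A B : idomainType) (h : {rmorphism A -> B}) :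
  injective h -> exists2 phi : {rmorphism {fraction A} -> {fraction B}},
    phi =1 frac_map h & forall P, phi P%:F = (h P)%:F.
Proof.
move=> hI; have hI' : injective ((@FracField.tofrac B) \o h).
  by move=> P Q /= /eqP; rewrite tofrac_eq (inj_eq hI) => /eqP.
have [phi phiE] := frac_lift hI'; exists phi => [f|P].
  by rewrite {1}(frac_repr f) phiE // denom_ratioP.
by rewrite -[P%:F]divr1 -tofrac1 phiE ?oner_eq0 //= rmorph1 tofrac1 divr1.
Qed.

End FractionMorphisms.

(** * Kernel vectors from maximal minors *)

Section CofactorKernel.
Local Open Scope ring_scope.

(** The signed maximal minors of [M], as cofactors along a zero column put in front of [M]; the
    entries of that column do not affect them. *)
Definition cofactor_row (A : comNzRingType) n (M : 'M[A]_(n.+1, n)) : 'rV[A]_n.+1 :=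
  \row_i cofactor (row_mx (0 : 'cV_n.+1) M : 'M_(1 + n)) i 0.

Lemma det_cofactor_row (A : comNzRingType) n (M : 'M[A]_(n.+1, n)) (v : 'cV_n.+1) :
  \det (row_mx v M : 'M_(1 + n)) = (cofactor_row M *m v) 0 0.
Proof.
rewrite (expand_det_col _ 0) mxE; apply: eq_bigr => i _; rewrite [in RHS]mxE mulrC.
congr (_ * _); last by rewrite mxE split1 unlift_none.
rewrite /cofactor; congr (_ * \det _).
by apply/matrixP => k l; rewrite !mxE !split1 !liftK.
Qed.

(** Repeating a column of [M] in front of [M] gives determinant zero. *)
Lemma cofactor_row_mul (A : comNzRingType) n (M : 'M[A]_(n.+1, n)) :
  cofactor_row M *m M = 0.
Proof.
apply/rowP => j; transitivity ((cofactor_row M *m col j M) 0 0).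
  by rewrite !mxE; apply: eq_bigr => i _; rewrite !mxE.
rewrite -det_cofactor_row -det_tr mxE.
apply: (@determinant_alternate _ _ _ (lshift n 0) (rshift 1 j)) => //.
by move=> i; rewrite !mxE (unsplitK (inl _)) (unsplitK (inr _)) mxE.
Qed.

Lemma map_cofactor_row (A B : comNzRingType) (f : {rmorphism A -> B}) n
    (M : 'M[A]_(n.+1, n)) :
  map_mx f (cofactor_row M) = cofactor_row (map_mx f M).
Proof.
by apply/rowP => i; rewrite !mxE -cofactor_map_mx map_row_mx map_mx0.
Qed.

(** If the [i]-th minor is nonzero, [M] completed by the [i]-th unit column is invertible, and it
    kills the difference between [z] and the multiple of the minors with the same [i]-th entry. *)
Lemma cofactor_row_span (K : fieldType) n (M : 'M[K]_(n.+1, n)) (z : 'rV_n.+1) :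
  cofactor_row M != 0 -> z *m M = 0 -> exists c, z = c *: cofactor_row M.
Proof.
have := cofactor_row_mul M; have := det_cofactor_row M.
move: (cofactor_row M) => y detE yM y0 zM.
have [i yi] : exists i, y 0 i != 0 by apply/rV0Pn.
exists (z 0 i / y 0 i); apply/eqP; rewrite -subr_eq0; apply/eqP.
set w := _ - _; pose D : 'M_(1 + n) := row_mx (delta_mx i 0) M.
have wM : w *m M = 0 by rewrite mulmxBl -scalemxAl yM zM scaler0 subr0.
have wi : w *m delta_mx i (0 : 'I_1) = 0.
  by apply/matrixP => k l; rewrite -colE !mxE !ord1 divfK // subrr.
have wD : w *m D = 0 by rewrite mul_mx_row wM wi row_mx0.
have uD : D \in unitmx.
  by rewrite unitmxE detE unitfE -colE mxE.
by rewrite -[w]mulmx1 -(mulmxV uD) mulmxA wD mul0mx.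
Qed.

(** If all minors vanished, [M] completed by the [i]-th unit column would be singular: some nonzero
    kernel vector of [M] would have [i]-th entry zero, unlike every nonzero multiple of [v]. *)
Lemma cofactor_row_neq0 (K : fieldType) n (M : 'M[K]_(n.+1, n)) (v : 'rV_n.+1) :
  v != 0 -> (forall z, z *m M = 0 -> exists c, z = c *: v) -> cofactor_row M != 0.
Proof.
move=> /rV0Pn [i vi] kerM; apply/eqP => y0.
pose D : 'M_(1 + n) := row_mx (delta_mx i 0) M.
have : \det D = 0 by rewrite det_cofactor_row y0 mul0mx mxE.
move/eqP/det0P => [w w0] wD.
have wM : w *m M = 0 by have := congr1 rsubmx wD; rewrite mul_mx_row row_mxKr linear0.
have wi : w *m delta_mx i (0 : 'I_1) = 0.
  by have := congr1 lsubmx wD; rewrite mul_mx_row row_mxKl linear0.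
have [c Dw] := kerM w wM; move: w0; rewrite Dw.
suff -> : c = 0 by rewrite scale0r eqxx.
move: wi; rewrite -colE Dw => /matrixP/(_ 0 0); rewrite !mxE => /eqP.
by rewrite mulf_eq0 (negPf vi) orbF => /eqP.
Qed.

(** The vector is a family over all commutative rings, to be specialized later; the equation
    [k = n.+1] avoids casts when the size is not syntactically a successor. *)
Lemma kernel_vector k n : k = n.+1 ->
  exists y : forall A : comNzRingType, 'M[A]_(k, n) -> 'rV[A]_k,
  [/\ forall A M, y A M *m M = 0,
      forall (A B : comNzRingType) (f : {rmorphism A -> B}) M,
        map_mx f (y A M) = y B (map_mx f M),
      forall (K : fieldType) (M : 'M[K]_(k, n)) (z : 'rV_k),
        y K M != 0 -> z *m M = 0 -> exists c, z = c *: y K M &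
      forall (K : fieldType) (M : 'M[K]_(k, n)) (v : 'rV_k), v != 0 ->
        (forall z : 'rV_k, z *m M = 0 -> exists c, z = c *: v) -> y K M != 0].
Proof.
move=> ->; exists (fun A M => cofactor_row M); split=> *.
- exact: cofactor_row_mul.
- exact: map_cofactor_row.
- exact: cofactor_row_span.
- by apply: cofactor_row_neq0; eassumption.
Qed.

End CofactorKernel.

(** * The interpolation system *)

Section InterpolationSystem.
Local Open Scope ring_scope.
Variables (N p r : nat).

(** Rescalings of the points and coefficients of the curve are packed into one row, so that passing
    through the rescaled points is a single linear system. *)
Definition interp_defect (A : comNzRingType) (V : 'M[A]_(N, r)) (X : 'M[A]_(N, p))
    (z : 'rV[A]_(N + r * p)) : 'rV[A]_(N * p) :=
  mxvec (diag_mx (lsubmx z) *m X - V *m vec_mx (rsubmx z)).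

Lemma interp_defect_linear (A : comNzRingType) V X : linear (@interp_defect A V X).
Proof.
move=> c u v; rewrite /interp_defect.
have -> : diag_mx (lsubmx (c *: u + v)) = c *: diag_mx (lsubmx u) + diag_mx (lsubmx v).
  by rewrite !linearP.
have -> : vec_mx (rsubmx (c *: u + v)) = c *: vec_mx (rsubmx u) + vec_mx (rsubmx v) :> 'M_(r, p).
  by rewrite !linearP.
by rewrite mulmxDl -scalemxAl mulmxDr -scalemxAr opprD addrACA -scalerBr linearP.
Qed.

HB.instance Definition _ (A : comNzRingType) V X :=
  GRing.isLinear.Build A _ _ _ (@interp_defect A V X) (interp_defect_linear V X).

(** The pair [(lam, cf)] may vanish at special configurations; over a field it is nonzero exactly
    when the solutions form a line. *)
Lemma interp_solution : (N + r * p = (N * p).+1)%N ->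
  exists (lam : forall A : comNzRingType, 'M[A]_(N, r) -> 'M[A]_(N, p) -> 'rV[A]_N)
    (cf : forall A : comNzRingType, 'M[A]_(N, r) -> 'M[A]_(N, p) -> 'M[A]_(r, p)),
  [/\ forall (A : comNzRingType) V X,
        diag_mx (lam A V X) *m X = V *m cf A V X,
      forall (A B : comNzRingType) (f : {rmorphism A -> B}) V X,
        map_mx f (lam A V X) = lam B (map_mx f V) (map_mx f X) /\
        map_mx f (cf A V X) = cf B (map_mx f V) (map_mx f X),
      forall (K : fieldType) V X lam' cf', (lam K V X, cf K V X) <> (0, 0) ->
        diag_mx lam' *m X = V *m cf' ->
        exists c, lam' = c *: lam K V X /\ cf' = c *: cf K V X &
      forall (K : fieldType) V X lam0 cf0, (lam0, cf0) <> (0, 0) ->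
        (forall lam' cf', diag_mx lam' *m X = V *m cf' ->
           exists c : K, lam' = c *: lam0 /\ cf' = c *: cf0) ->
        (lam K V X, cf K V X) <> (0, 0)].
Proof.
move=> /kernel_vector [y [yM ymap yspan yn0]].
pose sys (A : comNzRingType) (V : 'M[A]_(N, r)) X := lin1_mx (interp_defect V X).
have sysE (A : comNzRingType) (V : 'M[A]_(N, r)) X z :
    (z *m sys A V X == 0) = (diag_mx (lsubmx z) *m X == V *m vec_mx (rsubmx z)).
  by rewrite mul_rV_lin1 /= /interp_defect -[0](linear0 mxvec) (can_eq mxvecK) subr_eq0.
have map_sys (A B : comNzRingType) (f : {rmorphism A -> B}) (V : 'M[A]_(N, r)) X :
    map_mx f (sys A V X) = sys B (map_mx f V) (map_mx f X).
  apply: map_lin1_mx => v.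
  rewrite /interp_defect map_mxvec map_mxB !map_mxM map_diag_mx map_lsubmx.
  by rewrite map_vec_mx map_rsubmx.
pose lam (A : comNzRingType) (V : 'M[A]_(N, r)) X := lsubmx (y A (sys A V X)).
pose cf (A : comNzRingType) (V : 'M[A]_(N, r)) X :=
  vec_mx (rsubmx (y A (sys A V X))) : 'M[A]_(r, p).
have y0 (K : fieldType) (V : 'M[K]_(N, r)) X :
    y K (sys K V X) != 0 <-> (lam K V X, cf K V X) <> (0, 0).
  split=> [/eqP yn [l0 c0]|yn].
    apply: yn; rewrite -[LHS]hsubmxK; move: l0; rewrite /lam => ->.
    by rewrite -[rsubmx _]vec_mxK -/(cf K V X) c0 linear0 row_mx0.
  by apply/eqP => y0; apply: yn; rewrite /lam /cf y0 !linear0.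
exists lam, cf; split.
- by move=> A V X; apply/eqP; rewrite -sysE yM.
- move=> A B f V X; rewrite /lam /cf -map_sys -ymap.
  by rewrite map_lsubmx map_vec_mx map_rsubmx.
- move=> K V X lam' cf' /y0 yn E.
  have [|c Ec] := yspan K _ (row_mx lam' (mxvec cf')) yn.
    by apply/eqP; rewrite sysE row_mxKl row_mxKr mxvecK E.
  exists c; split; first by rewrite -[lam'](row_mxKl _ (mxvec cf')) Ec linearZ.
  by rewrite -[cf']mxvecK -[mxvec cf'](row_mxKr lam') Ec !linearZ.
move=> K V X lam0 cf0 n0 uni; apply/y0/(yn0 _ _ (row_mx lam0 (mxvec cf0))).
  apply/eqP => E0; apply: n0; congr (_, _).
    by rewrite -[LHS](row_mxKl _ (mxvec cf0)) E0 linear0.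
  by rewrite -[LHS]mxvecK -[mxvec cf0](row_mxKr lam0) E0 !linear0.
move=> z /eqP; rewrite sysE => /eqP /uni [c [El Ec]]; exists c.
by rewrite -[LHS]hsubmxK El -[rsubmx z]vec_mxK Ec scale_row_mx linearZ.
Qed.

End InterpolationSystem.

(* From here on, [p.+1] is the number of homogeneous coordinates, the [p] of the theorem. *)
Lemma exponent_arrangement m p : 0 < m -> exists q (eps : 'I_(p.+1 + q) -> nat),
  [/\ p.+1 + q = p * m + 1, injective eps, forall c, eps c < p * m + 1 &
      forall j : 'I_p.+1, eps (lshift q j) = m * j].
Proof.
(* The multiples of [m] come first, to index the block normalized to the identity. There remain
   [q = p * (m - 1)] exponents, and [q * p.+1] is the dimension of the moduli space. *)
move=> m0; pose s1 := [seq m * j | j <- iota 0 p.+1].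
pose s2 := [seq e <- iota 0 (p * m + 1) | ~~ (m %| e)].
have ps : perm_eq (s1 ++ s2) (iota 0 (p * m + 1)).
  apply: uniq_perm; [|exact: iota_uniq|].
    rewrite cat_uniq filter_uniq ?iota_uniq // andbT map_inj_uniq ?iota_uniq /=.
      apply/hasPn => e; rewrite mem_filter => /andP [me _].
      by apply: contra me => /mapP [j _ ->]; rewrite dvdn_mulr.
    by move=> i j /eqP; rewrite eqn_pmul2l // => /eqP.
  move=> e; rewrite mem_cat mem_filter !mem_iota !add0n /=.
  have [/dvdnP [k ->]|nme] /= := boolP (m %| e).
    rewrite orbF mulnC addn1 ltnS [p * m]mulnC leq_pmul2l //.
    rewrite mem_map ?mem_iota //.
    by move=> i j /eqP; rewrite eqn_pmul2l // => /eqP.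
  case: mapP => //= -[j _ Ej]; by move: nme; rewrite Ej dvdn_mulr.
have ss := perm_size ps; rewrite size_cat size_map !size_iota in ss.
exists (size s2), (fun c => nth 0 (s1 ++ s2) c); split=> //.
- move=> c d /eqP; rewrite nth_uniq ?size_cat ?size_map ?size_iota //.
    by move=> /eqP; apply: val_inj.
  by rewrite (perm_uniq ps) iota_uniq.
- move=> c; have : nth 0 (s1 ++ s2) c \in s1 ++ s2.
    by apply: mem_nth; rewrite size_cat size_map size_iota.
  by rewrite (perm_mem ps) mem_iota.
- move=> j; rewrite -[LHS]/(nth 0 (s1 ++ s2) j) nth_cat size_map size_iota ltn_ord.
  by rewrite (nth_map 0) ?size_iota // nth_iota.
Qed.

(** * The monomial configuration *)

Section MonomialConfiguration.
Local Open Scope ring_scope.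
Variables (m p q N : nat) (eps : 'I_(p.+1 + q) -> nat).
Hypotheses (eps_inj : injective eps) (eps_lt : forall c, (eps c < p * m + 1)%N).
Hypothesis eps_l : forall j : 'I_p.+1, eps (lshift q j) = (m * j)%N.
Hypothesis EN : N = (p.+1 * m + 1)%N.

Definition power_mx (A : comNzRingType) (a : 'rV[A]_N) : 'M[A]_(N, p.+1 + q) :=
  \matrix_(i, c) a 0 i ^+ eps c.

(** The points of the curve whose coefficient matrix has the identity as upper block; as [T] varies,
    a section of the generic orbits of rescaling and [GL_p]. *)
Definition slice (A : comNzRingType) (V : 'M[A]_(N, p.+1 + q)) (T : 'M[A]_(q, p.+1)) :
    'M[A]_(N, p.+1) :=
  V *m col_mx 1%:M T.

Lemma poly_eq_on_points (K : fieldType) (a : 'rV[K]_N) (P Q : {poly K}) :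
  injective (a 0) -> (size P <= N)%N -> (size Q <= N)%N ->
  (forall i, P.[a 0 i] = Q.[a 0 i]) -> P = Q.
Proof.
move=> a_inj sP sQ PQ; apply/eqP; rewrite -subr_eq0; apply/eqP.
apply: (@roots_geq_poly_eq0 _ _ [seq a 0 i | i <- enum 'I_N]).
- by apply/allP => _ /mapP [i _ ->]; rewrite /root !hornerE PQ subrr.
- by rewrite map_inj_uniq // enum_uniq.
rewrite size_map size_enum_ord (leq_trans (size_polyD _ _)) // size_polyN.
by rewrite geq_max sP.
Qed.

(* The solution polynomials [w j] satisfy [w j = 'X^(m * j) * w 0], so the degree bound
   for [j = p] forces [w 0] to be constant. *)
Lemma monomial_config_unique (K : fieldType) (a : 'rV[K]_N) lam C :
  injective (a 0) ->
  diag_mx lam *m slice (power_mx a) 0 = power_mx a *m C ->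
  exists c, lam = c *: const_mx 1 /\ C = c *: col_mx 1%:M 0.
Proof.
move=> a_inj E.
pose w j : {poly K} := \sum_c C c j *: 'X^(eps c).
have w_size j : (size (w j) <= p * m + 1)%N.
  apply: (leq_trans (size_sum _ _ _)); apply/bigmax_leqP => c _.
  by rewrite (leq_trans (size_scale_leq _ _)) // size_polyXn.
have wE i (j : 'I_p.+1) : lam 0 i * a 0 i ^+ (m * j)%N = (w j).[a 0 i].
  have /matrixP/(_ i j) := E; rewrite mul_diag_mx !mxE horner_sum => E'.
  transitivity (\sum_j0 (power_mx a) i j0 * C j0 j); last first.
    by apply: eq_bigr => c _; rewrite !hornerE mxE mulrC.
  rewrite -E'; congr (_ * _); rewrite (bigD1 (lshift q j)) //= !mxE.
  rewrite (unsplitK (inl j)) mxE eqxx mulr1 eps_l big1 ?addr0 // => c.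
  rewrite !mxE; case: splitP => k Ek nk; rewrite mxE ?mulr0 //.
  have -> : (k == j) = false; last by rewrite mulr0.
  by apply: contraNF nk => /eqP <-; apply/eqP/val_inj.
have wj j (ltj : (j < p.+1)%N) : w (Ordinal ltj) = 'X^(m * j) * w 0.
  elim: j ltj => [|j IHj] ltj.
    by rewrite muln0 mul1r; congr w; apply: val_inj.
  have ltj' := ltnW ltj.
  (* The value of [N] enters here: the degree is at most [p * m + m = N - 1], so the [N] values
     determine the polynomial. *)
  have szw : (size ('X^m * w (Ordinal ltj'))%R <= N)%N.
    rewrite (leq_trans (size_polyMleq _ _)) // size_polyXn EN mulSn -addnA /=.
    by rewrite leq_add2l w_size.
  have -> : 'X^(m * j.+1) * w 0 = 'X^m * w (Ordinal ltj').
    by rewrite IHj mulrA -exprD mulnS.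
  apply: (poly_eq_on_points a_inj) => //.
    rewrite (leq_trans (w_size _)) // EN leq_add2r leq_mul2r.
    by rewrite leqnSn orbT.
  by move=> i; rewrite hornerM hornerXn -!wE /= mulnS exprD mulrCA.
have w0 : (size (w 0%R) <= 1)%N.
  have [->|w0] := eqVneq (w 0) 0; first by rewrite size_poly0.
  have := w_size (Ordinal (ltnSn p)); rewrite wj mulrC size_mulXn //.
  by rewrite mulnC leq_add2l.
move: (size1_polyC w0); set c := (w 0)`_0 => Ew0; exists c; split.
  apply/rowP => i; rewrite !mxE mulr1.
  by have := wE i 0; rewrite muln0 mulr1 Ew0 hornerC.
apply/matrixP => e j.
have Cw : C e j = (w j)`_(eps e).
  rewrite /w coef_sum (bigD1 e) //= coefZ coefXn eqxx mulr1 big1 ?addr0 // => d de.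
  by rewrite coefZ coefXn (inj_eq eps_inj) eq_sym (negPf de) mulr0.
have -> : C e j = c * (eps e == m * j)%N%:R.
  case: j Cw => j ltj Cw; rewrite Cw wj Ew0 coefXnM coefC.
  have [lte|le] := ltnP; first by rewrite ltn_eqF // mulr0.
  rewrite subn_eq0; have [le'|lt'] := leqP (eps e) (m * j).
    by rewrite eqn_leq le le' mulr1.
  by rewrite gtn_eqF // mulr0.
rewrite !mxE; congr (_ * _); rewrite -eps_l (inj_eq eps_inj).
case: splitP => k Ek; rewrite mxE.
  by congr (_%:R); congr nat_of_bool; rewrite -!(inj_eq val_inj) /= Ek.
by rewrite -(inj_eq val_inj) /= Ek gtn_eqF // ltn_addr.
Qed.

End MonomialConfiguration.

(** * Evaluation at matrices, density and rescaling *)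

Section MatrixEvaluation.
Local Open Scope ring_scope.

Definition eval_mx (K L : comNzRingType) (f : K -> L) m n (Y : 'M[L]_(m, n))
    (P : {mpoly K[m * n]}) : L :=
  mmap f (fun k => mxvec Y 0 k) P.

Section Morphism.
Variables (K L : comNzRingType) (f : {rmorphism K -> L}) (m n : nat) (Y : 'M[L]_(m, n)).

Lemma eval_mx_zmod : zmod_morphism (eval_mx f Y).
Proof. exact: mmap_is_additive. Qed.

Lemma eval_mx_monoid : monoid_morphism (eval_mx f Y).
Proof.
pose h k : L := mxvec Y 0 k.
by split=> [|P Q]; [exact: (rmorph1 (mmap f h))|exact: (rmorphM (mmap f h))].
Qed.

HB.instance Definition _ := GRing.isZmodMorphism.Build _ _ (eval_mx f Y) eval_mx_zmod.
HB.instance Definition _ := GRing.isMonoidMorphism.Build _ _ (eval_mx f Y) eval_mx_monoid.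

Lemma eval_mxC c : eval_mx f Y c%:MP = f c.
Proof. exact: mmapC. Qed.

Lemma eval_mxX i j : eval_mx f Y 'X_(mxvec_index i j) = Y i j.
Proof. by rewrite /eval_mx mmapX mmap1U mxvecE. Qed.

End Morphism.

Lemma map_gen_points_eval (K : fieldType) (L : comNzRingType) (f : {rmorphism K -> L}) m n
    (Y : 'M[L]_(m, n)) : map_mx (eval_mx f Y) (gen_points K m n) = Y.
Proof. by apply/matrixP => i j; rewrite !mxE eval_mxX. Qed.

Lemma eval_mx_unique (K : fieldType) (L : comNzRingType) m n
    (h : {rmorphism {mpoly K[m * n]} -> L}) (f : {rmorphism K -> L}) (Y : 'M[L]_(m, n)) :
  (forall c, h c%:MP = f c) -> map_mx h (gen_points K m n) = Y -> h =1 eval_mx f Y.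
Proof.
move=> hC hX; apply: mpoly_rmorph_eq => [c|k]; first by rewrite hC /= eval_mxC.
case/mxvec_indexP: k => i j; rewrite /= eval_mxX -hX.
by rewrite !mxE.
Qed.

Lemma rmorph_eval_mx (K : fieldType) (L L' : comNzRingType) (f : {rmorphism K -> L})
    (f' : {rmorphism K -> L'}) (g : {rmorphism L -> L'}) m n (Y : 'M[L]_(m, n)) P :
  (forall c, g (f c) = f' c) -> g (eval_mx f Y P) = eval_mx f' (map_mx g Y) P.
Proof.
move=> gf; apply: (@eval_mx_unique _ _ _ _ (g \o eval_mx f Y)) => [c|].
  by rewrite /= eval_mxC gf.
by rewrite map_mx_comp map_gen_points_eval.
Qed.

Lemma eval_multihomog (K : fieldType) (L : comNzRingType) (f : {rmorphism K -> L}) m n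
    (mu : 'rV[L]_m) (Y : 'M[L]_(m, n)) d (P : {mpoly K[m * n]}) : multihomog d P ->
  eval_mx f (diag_mx mu *m Y) P = (\prod_i mu 0 i ^+ d i) * eval_mx f Y P.
Proof.
move=> homP; rewrite /eval_mx /mmap mulr_sumr big_seq [RHS]big_seq.
apply: eq_bigr => mon monP; rewrite mulrCA; congr (_ * _); rewrite /mmap1.
have prodE (Z : 'M[L]_(m, n)) : \prod_k mxvec Z 0 k ^+ mon k =
    \prod_i \prod_j Z i j ^+ mon (mxvec_index i j).
  rewrite (reindex (uncurry (@mxvec_index m n))) /=; last exact: curry_mxvec_bij.
  by rewrite [RHS]pair_bigA; apply: eq_bigr => -[i j] _; rewrite /= mxvecE.
rewrite !prodE -big_split; apply: eq_bigr => i _ /=.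
rewrite -(homP _ monP i) expr_sum -big_split; apply: eq_bigr => j _ /=.
by rewrite mul_diag_mx mxE exprMn.
Qed.

(** Coordinates are moved into [F] one at a time: freeing one of them leaves a nonzero polynomial in
    one variable, which cannot vanish on the infinite field [F]. *)
Lemma eval_density (F E : fieldType) (j : {rmorphism F -> E}) n (R : {mpoly E[n]}) v :
  infinite_field F -> R.@[v] != 0 -> exists v0 : 'I_n -> F, R.@[fun k => j (v0 k)] != 0.
Proof.
move=> hF Rv.
suff [v' Rv' /choice [v0 v0E]] : exists2 v' : 'I_n -> E, R.@[v'] != 0 &
    forall k, exists c, v' k = j c.
  by exists v0; rewrite (meval_eq (v2 := v')).
suff [v' Rv' jv'] : exists2 v' : 'I_n -> E, R.@[v'] != 0 &
    forall k, k \in enum 'I_n -> exists c, v' k = j c.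
  by exists v' => // k; apply: jv'; rewrite mem_enum.
elim: (enum _) => [|i s [v' Rv' jv']]; first by exists v.
pose h k : {poly E} := if k == i then 'X else (v' k)%:P.
pose P : {poly E} := mmap (@polyC E) h R.
have PE t : P.[t] = R.@[fun k => if k == i then t else v' k].
  rewrite /P /mmap mevalE horner_sum; apply: eq_bigr => mon _.
  rewrite hornerM hornerC /mmap1 horner_prod; congr (_ * _).
  by apply: eq_bigr => k _; rewrite horner_exp /h; case: eqP => _; rewrite !hornerE.
have P0 : P != 0.
  apply: contraNneq Rv' => P0; have := PE (v' i).
  rewrite P0 horner0 => H; apply/eqP; rewrite H; apply: meval_eq => k.
  by case: eqP => [->|].
have [c] := infinite_nonroot hF j P0; rewrite /root PE => Rc.
exists (fun k => if k == i then j c else v' k) => // k; rewrite inE.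
by case: eqP => [_ _|_ /= /jv' //]; exists c.
Qed.

Section Scaling.
Variables (K : fieldType) (N p : nat).
Local Notation A := {mpoly K[N * p]}.
Local Notation "x %:F" := (@FracField.tofrac _ x).

Definition scale_subst (mu : 'rV[K]_N) : A -> A :=
  eval_mx (@mpolyC _ _) (diag_mx (map_mx (@mpolyC (N * p) K) mu) *m gen_points K N p).

HB.instance Definition _ mu := GRing.RMorphism.on (scale_subst mu).

Definition weight (mu : 'rV[K]_N) (mon : 'X_{1..N * p}) : K :=
  \prod_i mu 0 i ^+ (\sum_j mon (mxvec_index i j)).

Lemma scale_substX mu mon : scale_subst mu 'X_[mon] = weight mu mon *: 'X_[mon].
Proof.
rewrite /scale_subst (@eval_multihomog _ _ _ _ _ _ _ (fun i => \sum_j mon (mxvec_index i j))%N).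
  rewrite -mul_mpolyC /weight rmorph_prod; congr (_ * _).
    by apply: eq_bigr => i _; rewrite mxE rmorphXn.
  symmetry; apply: (@eval_mx_unique _ _ _ _ idfun) => //.
  by apply/matrixP => i j; rewrite !mxE.
by move=> mon'; rewrite msuppX inE => /eqP ->.
Qed.

Lemma mcoeff_scale_subst mu P mon : (scale_subst mu P)@_mon = weight mu mon * P@_mon.
Proof.
rewrite [in LHS](mpolyE P) [in RHS](mpolyE P) (raddf_sum (scale_subst mu)).
rewrite !(raddf_sum (mcoeff mon)) mulr_sumr; apply: eq_bigr => mon' _.
rewrite -mul_mpolyC /= (rmorphM (scale_subst mu)) /= scale_substX /scale_subst eval_mxC.
rewrite !mul_mpolyC !mcoeffZ mcoeffX.
by case: eqP => [->|]; rewrite ?mulr0 // mulrCA.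
Qed.

Lemma scale_subst_inj (mu : 'rV[K]_N) : (forall i, mu 0 i != 0) -> injective (scale_subst mu).
Proof.
move=> mu0 P Q /mpolyP PQ; apply/mpolyP => mon; have := PQ mon.
rewrite !mcoeff_scale_subst; apply: mulfI.
by apply/prodf_neq0 => i _; rewrite expf_neq0.
Qed.

(* A fraction with a denominator of minimal support has a multihomogeneous one:
   otherwise a rescaling followed by a subtraction would shrink the support. *)
Lemma proj_funfield_scale_invariant (F : fieldType) (iota : {rmorphism F -> K})
    (f : {fraction A}) : infinite_field F ->
  (forall mu : 'rV[K]_N, (forall i, mu 0 i != 0) -> frac_map (scale_subst mu) f = f) ->
  proj_funfield f.
Proof.
move=> hF f_inv.
pose ann n := `[< exists P Q : A, [/\ Q != 0, f * Q%:F = P%:F & size (msupp Q) = n] >].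
have ex_ann : exists n, ann n.
  have [P [Q [Q0 fE]]] := fracP f; exists (size (msupp Q)); apply/asboolP.
  by exists P, Q; rewrite fE divfK // tofrac_eq0.
case: (ex_minnP ex_ann) => n /asboolP [P [Q [Q0 fQ sQ]]] min_n.
have [mon0 Qmon0] : exists mon0, mon0 \in msupp Q.
  case E : (msupp Q) => [|mon0 s]; last by exists mon0; rewrite mem_head.
  by move/eqP: E; rewrite msupp_eq0 (negPf Q0).
have hom_eq (mu : 'rV[K]_N) : (forall i, mu 0 i != 0) ->
    scale_subst mu Q = weight mu mon0 *: Q /\ scale_subst mu P = weight mu mon0 *: P.
  move=> mu0; set c := weight mu mon0.
  have [phi phi_f phiE] := frac_map_rmorph (scale_subst_inj mu0).
  pose Q' := scale_subst mu Q - c *: Q; pose P' := scale_subst mu P - c *: P.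
  have fQ' : f * Q'%:F = P'%:F.
    have sf : phi f = f by rewrite phi_f; exact: f_inv.
    have := congr1 phi fQ; rewrite rmorphM sf !phiE => fsQ.
    by rewrite /Q' /P' -!mul_mpolyC !tofracB !tofracM mulrBr mulrCA fQ fsQ.
  have Q'0 : Q' = 0.
    apply/eqP; apply: contraT => Q'0.
    have : (n <= size (msupp Q'))%N by apply/min_n/asboolP; exists P', Q'.
    rewrite leqNgt -sQ (perm_size (perm_to_rem Qmon0)) /= ltnS.
    case/negP; apply: uniq_leq_size => [|mon]; first exact: msupp_uniq.
    rewrite mem_rem_uniq ?msupp_uniq // inE !mcoeff_msupp /Q' mcoeffB mcoeffZ.
    rewrite mcoeff_scale_subst -mulrBl mulf_eq0 negb_or subr_eq0 => /andP [ne ->].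
    by rewrite andbT; apply: contraNneq ne => ->.
  have P'0 : P' = 0 by apply/eqP; rewrite -tofrac_eq0 -fQ' Q'0 tofrac0 mulr0.
  by split; apply/eqP; rewrite -subr_eq0; apply/eqP.
exists (fun i => (\sum_j mon0 (mxvec_index i j))%N), P, Q.
have hom R : (forall mu : 'rV[K]_N, (forall i, mu 0 i != 0) ->
      scale_subst mu R = weight mu mon0 *: R) ->
    multihomog (fun i => (\sum_j mon0 (mxvec_index i j))%N) R.
  move=> homR mon Rmon i; apply/eqP; apply: contraT => ne.
  set a := (X in X == _) in ne; set b := (X in _ == X) in ne.
  (* A non-root of [D] is nonzero, so it may rescale the [i]-th point, and it tells the degrees [a]
     and [b] apart. *)
  pose D : {poly K} := 'X * ('X^a - 'X^b).
  have D0 : D != 0.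
    rewrite mulf_neq0 ?polyX_eq0 // subr_eq0; apply: contraNneq ne => /polyP/(_ a).
    by rewrite !coefXn eqxx; case: eqP => [|_ /eqP]; rewrite ?oner_eq0.
  have [c] := infinite_nonroot hF iota D0.
  rewrite /root !hornerE mulf_eq0 negb_or subr_eq0 => /andP [c0 cab].
  pose mu : 'rV[K]_N := \row_k (if k == i then iota c else 1).
  have mu0 k : mu 0 k != 0 by rewrite mxE; case: ifP => _; rewrite ?oner_eq0.
  have wE mon' : weight mu mon' = iota c ^+ (\sum_j mon' (mxvec_index i j)).
    rewrite /weight (bigD1 i) //= mxE eqxx [X in _ * X]big1 ?mulr1 // => k ki.
    by rewrite mxE (negPf ki) expr1n.
  have /mpolyP/(_ mon) := homR mu mu0; rewrite mcoeff_scale_subst mcoeffZ.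
  move/mulIf; rewrite -mcoeff_msupp => /(_ Rmon); rewrite !wE => Eab.
  by move: cab; rewrite /a /b Eab eqxx.
split=> //.
- by apply: hom => mu /hom_eq [].
- by apply: hom => mu /hom_eq [].
- by rewrite -fQ mulfK // tofrac_eq0.
Qed.

End Scaling.
End MatrixEvaluation.

(** * Normal form of the generic configuration *)

Section NormalForm.
Local Open Scope ring_scope.
Local Notation "x %:F" := (@FracField.tofrac _ x).
Variables (Fs : fieldType) (m p q N : nat) (eps : 'I_(p.+1 + q) -> nat).
Hypotheses (eps_inj : injective eps) (eps_lt : forall c, (eps c < p * m + 1)%N).
Hypothesis eps_l : forall j : 'I_p.+1, eps (lshift q j) = (m * j)%N.
Hypotheses (EN : N = (p.+1 * m + 1)%N) (Er : (p.+1 + q = p * m + 1)%N).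
Variable a : 'rV[Fs]_N.
Hypothesis a_inj : injective (a 0).

Local Notation A := {mpoly Fs[N * p.+1]}.
Local Notation B := {mpoly Fs[q * p.+1]}.

Definition const_fracs n : {rmorphism Fs -> {fraction {mpoly Fs[n]}}} :=
  (@FracField.tofrac _) \o (@mpolyC n Fs).

Local Notation E := {fraction A}.
Local Notation kE := (const_fracs (N * p.+1)).
Local Notation V := (power_mx eps a).

Definition gen_points_frac : 'M[E]_(N, p.+1) :=
  map_mx (@FracField.tofrac _) (gen_points Fs N p.+1).

Local Notation XE := gen_points_frac.
Local Notation VE := (map_mx kE V).

Lemma map_slice (R S : comNzRingType) (f : {rmorphism R -> S}) (W : 'M[R]_(N, p.+1 + q)) T :
  map_mx f (slice W T) = slice (map_mx f W) (map_mx f T).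
Proof. by rewrite /slice map_mxM map_col_mx map_mx1. Qed.

Lemma eval_gen_points_frac P : eval_mx kE XE P = P%:F.
Proof.
symmetry; apply: (@eval_mx_unique _ _ _ _ (@FracField.tofrac A)) => //.
Qed.

(** The solution is computed over [A], and [G] inverts the upper block of its coefficient matrix;
    specialization at the monomial configuration shows that this block is invertible and that the
    scalings are nonzero. The entries of [T] are algebraically independent because on the slice
    itself they become its free parameters. *)
Lemma slice_normal_form :
  exists (T : 'M[E]_(q, p.+1)) (lam : 'rV[E]_N) (G : 'M[E]_p.+1),
  [/\ forall i, lam 0 i != 0, G \in unitmx, diag_mx lam *m XE *m G = slice VE T,
      forall T' lam' G', G' \in unitmx -> diag_mx lam' *m XE *m G' = slice VE T' ->
        T' = T &
      injective (eval_mx kE T : B -> E)].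
Proof.
have dimE : (N + (p.+1 + q) * p.+1 = (N * p.+1).+1)%N.
  rewrite Er EN; nia.
have [lam [cf [sys nat uni nz]]] := interp_solution dimE.
pose VA : 'M[A]_(N, p.+1 + q) := map_mx (@mpolyC _ _) V.
pose X := gen_points Fs N p.+1; pose lamA := lam A VA X; pose CA := cf A VA X.
pose X0 := slice V 0.
pose ev : {rmorphism A -> Fs} := eval_mx (@idfun Fs : {rmorphism Fs -> Fs}) X0.
have one0 (K : fieldType) (T : 'M[K]_(q, p.+1)) : col_mx 1%:M T <> 0.
  move=> /(congr1 usubmx); rewrite col_mxKu linear0 => /eqP.
  by rewrite (oner_eq0 ('M[K]_p.+1)).
have [c [c0 lam0 C0]] : exists c, [/\ c != 0, lam Fs V X0 = c *: const_mx 1 &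
    cf Fs V X0 = c *: col_mx 1%:M 0].
  have [c [lc Cc]] := monomial_config_unique eps_inj eps_lt eps_l EN a_inj (sys Fs V X0).
  exists c; split=> //.
  have : (lam Fs V X0, cf Fs V X0) <> (0, 0).
    apply: (nz _ _ _ (const_mx 1) (col_mx 1%:M 0)) => [[_ /one0] //|lam' C' E].
    exact: (monomial_config_unique eps_inj eps_lt eps_l EN a_inj E).
  by move=> H; apply/eqP => c0; apply: H; rewrite lc Cc c0 !scale0r.
have evV : map_mx ev VA = V by apply/matrixP => i j; rewrite !mxE /ev /= eval_mxC.
have evX : map_mx ev X = X0 by apply: map_gen_points_eval.
have ev_lam i : ev (lamA 0 i) = c.
  have /matrixP/(_ 0 i) := (nat _ _ ev VA X).1; rewrite evV evX lam0.
  by rewrite !mxE mulr1.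
have ev_C1 : map_mx ev (usubmx CA) = c%:M.
  by rewrite map_usubmx (nat _ _ ev VA X).2 evV evX C0 linearZ /= col_mxKu scalemx1.
pose D := \det (usubmx CA).
have evD : ev D != 0 by rewrite /D -det_map_mx ev_C1 det_scalar expf_neq0.
pose CE := map_mx (@FracField.tofrac _) CA; pose lamE := map_mx (@FracField.tofrac _) lamA.
have fVA : map_mx (@FracField.tofrac _) VA = VE by apply/matrixP => i j; rewrite !mxE.
have lamEE : lamE = lam E VE XE by rewrite /lamE (nat _ _ _ VA X).1 fVA.
have CEE : CE = cf E VE XE by rewrite /CE (nat _ _ _ VA X).2 fVA.
have uC1 : usubmx CE \in unitmx.
  rewrite unitmxE unitfE -map_usubmx det_map_mx tofrac_eq0.
  by apply: contraNneq evD => D0; rewrite /D D0 rmorph0.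
have lamE0 i : lamE 0 i != 0.
  by rewrite mxE tofrac_eq0; apply: contraNneq c0 => l0; rewrite -(ev_lam i) l0 rmorph0.
pose T := dsubmx CE *m invmx (usubmx CE).
have CT : CE *m invmx (usubmx CE) = col_mx 1%:M T.
  by rewrite -{1}(vsubmxK CE) mul_col_mx (mulmxV uC1).
have nz_gen : (lam E VE XE, cf E VE XE) <> (0, 0).
  rewrite -lamEE -CEE => -[_ CE0]; move: uC1; rewrite CE0 linear0.
  by rewrite unitmxE det0 unitr0.
have TE : T = dsubmx CE *m invmx (usubmx CE) by [].
exists T, lamE, (invmx (usubmx CE)); split.
- exact: lamE0.
- by rewrite unitmx_inv.
- by rewrite lamEE sys -mulmxA -CEE CT.
(* Undoing [G'] gives a solution of the system, hence a multiple of the generic one; comparison of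
   the upper blocks shows that [b *: G'] is the inverse of the generic upper block. *)
- move=> T' lam' G' uG' E'.
  have [|b [_ Cb]] := uni E VE XE lam' (col_mx 1%:M T' *m invmx G') nz_gen.
    by rewrite mulmxA -/(slice VE T') -E' mulmxK.
  have : col_mx 1%:M T' = CE *m (b *: G').
    by rewrite -scalemxAr scalemxAl CEE -Cb mulmxKV.
  rewrite -[CE]vsubmxK mul_col_mx => /eq_col_mx [E1 E2].
  rewrite E2 /T; congr (_ *m _).
  by rewrite -[LHS](mulKmx uC1) -E1 mulmx1.
(* [psi0] restricts functions to the slice with independent parameters [tau]. Setting [tau] to zero
   afterwards gives [ev], so whatever [ev] does not kill survives on the slice. *)
pose tau : 'M[B]_(q, p.+1) := gen_points Fs q p.+1.
pose psi0 : {rmorphism A -> B} :=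
  eval_mx (@mpolyC (q * p.+1) Fs) (slice (map_mx (@mpolyC _ _) V) tau).
have [psi psiE] : exists psi : {rmorphism A -> {fraction B}}, psi =1 (@FracField.tofrac B) \o psi0.
  by exists ((@FracField.tofrac B) \o psi0).
pose L := {fraction B}; pose VL : 'M[L]_(N, p.+1 + q) := map_mx (const_fracs _) V.
pose tauL : 'M[L]_(q, p.+1) := map_mx (@FracField.tofrac B) tau.
have psiX : map_mx psi X = slice VL tauL.
  rewrite (eq_map_mx _ psiE) map_mx_comp map_gen_points_eval map_slice; congr (slice _ _).
  by apply/matrixP => i j; rewrite !mxE.
have psiV : map_mx psi VA = VL by apply/matrixP => i j; rewrite !mxE psiE /= /psi0 /= eval_mxC.
have ev_psi P : eval_mx (@idfun Fs : {rmorphism Fs -> Fs}) 0 (psi0 P) = ev P.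
  rewrite /psi0 /= (@rmorph_eval_mx _ _ _ _ (@idfun Fs : {rmorphism Fs -> Fs})) => [|d].
    rewrite /ev /= /X0 map_slice map_gen_points_eval; congr (eval_mx _ (slice _ _) _).
    by apply/matrixP => i j; rewrite !mxE /= eval_mxC.
  by rewrite /= eval_mxC.
have psi0P P : ev P != 0 -> psi P != 0.
  move=> evP; rewrite psiE tofrac_eq0.
  by apply: contraNneq evP => P0; rewrite -ev_psi P0 rmorph0.
have nzL : (lam L VL (slice VL tauL), cf L VL (slice VL tauL)) <> (0, 0).
  rewrite -psiX -psiV -(nat _ _ psi VA X).1 -(nat _ _ psi VA X).2 => -[_ C0'].
  have /eqP := psi0P D evD; apply.
  by rewrite /D -det_map_mx map_usubmx C0' linear0 det0.
have [|b [_ Cb]] := uni L VL (slice VL tauL) (const_mx 1) (col_mx 1%:M tauL) nzL.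
  by rewrite diag_const_mx mul1mx.
have psiC : cf L VL (slice VL tauL) = map_mx psi CA.
  by rewrite (nat _ _ psi VA X).2 psiX psiV.
move: Cb; rewrite psiC -[map_mx psi CA]vsubmxK -map_usubmx -map_dsubmx.
rewrite scale_col_mx => /eq_col_mx [b1 b2].
(* [rel e l]: the fraction [e] is regular at the generic point of the slice,
   where it takes the value [l]. *)
pose rel (e : E) (l : L) := exists P Q : A, [/\ psi Q != 0, e = P%:F / Q%:F & l = psi P / psi Q].
have Q0F Q : psi Q != 0 -> Q%:F != 0 :> E.
  by move=> Q0; rewrite tofrac_eq0; apply: contraNneq Q0 => ->; rewrite rmorph0.
have relC d : rel (kE d) (const_fracs _ d).
  exists d%:MP, 1; rewrite rmorph1 tofrac1 !divr1 oner_eq0; split=> //.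
  by rewrite psiE /= /psi0 /= eval_mxC.
have relD e e' l l' : rel e l -> rel e' l' -> rel (e + e') (l + l').
  move=> [P [Q [Q0 -> ->]]] [P' [Q' [Q'0 -> ->]]]; exists (P * Q' + P' * Q), (Q * Q').
  split.
  - rewrite (rmorphM psi).
    exact: mulf_neq0 Q0 Q'0.
  - rewrite tofracD !tofracM.
    exact: addf_div (Q0F _ Q0) (Q0F _ Q'0).
  - rewrite (rmorphD psi) !(rmorphM psi).
    exact: addf_div Q0 Q'0.
have relM e e' l l' : rel e l -> rel e' l' -> rel (e * e') (l * l').
  move=> [P [Q [Q0 -> ->]]] [P' [Q' [Q'0 -> ->]]]; exists (P * P'), (Q * Q').
  split.
  - rewrite (rmorphM psi); exact: mulf_neq0 Q0 Q'0.
  - rewrite !tofracM; exact: mulf_div.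
  - rewrite !(rmorphM psi); exact: mulf_div.
have uL : map_mx psi (usubmx CA) \in unitmx.
  by rewrite unitmxE det_map_mx unitfE psi0P.
have invL : invmx (map_mx psi (usubmx CA)) = b%:M.
  by rewrite -[LHS]mulmx1 b1 -scalemxAr mulVmx // scalemx1.
have relT i j : rel (T i j) (tauL i j).
  exists ((dsubmx CA *m \adj (usubmx CA)) i j), D; split; first exact: psi0P.
    rewrite TE /invmx uC1 -scalemxAr mxE mulrC -map_usubmx det_map_mx; congr (_ / _).
    by rewrite -map_mx_adj -map_dsubmx -map_mxM mxE.
  transitivity ((map_mx psi (dsubmx CA) *m invmx (map_mx psi (usubmx CA))) i j).
    by rewrite invL b2 mul_mx_scalar.
  rewrite /invmx uL -scalemxAr mxE mulrC det_map_mx; congr (_ / _).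
  by rewrite -map_mx_adj -map_mxM mxE.
pose relB (R : B) := rel (eval_mx kE T R) R%:F.
have relBC d : relB d%:MP by rewrite /relB eval_mxC; apply: relC.
have relBD R S : relB R -> relB S -> relB (R + S).
  by move=> hR hS; rewrite /relB (rmorphD (eval_mx kE T)) tofracD; apply: relD.
have relBM R S : relB R -> relB S -> relB (R * S).
  by move=> hR hS; rewrite /relB (rmorphM (eval_mx kE T)) tofracM; apply: relM.
have relBX k : relB 'X_k.
  case/mxvec_indexP: k => i j; rewrite /relB eval_mxX.
  by have := relT i j; rewrite !mxE.
have relR R : relB R.
  rewrite (mpolyE R); apply: (big_ind relB) => [||mon _]; [exact: (relBC 0)|exact: relBD|].
  rewrite -mul_mpolyC; apply: (relBM); first exact: relBC.
  rewrite mpolyXE_id; apply: (big_ind relB) => [||k _]; [exact: (relBC 1)|exact: relBM|].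
  elim: (mon k) => [|d IHd]; first exact: (relBC 1).
  by rewrite exprS; apply: relBM => //; apply: relBX.
move=> R R' E'; apply/eqP; rewrite -subr_eq0 -tofrac_eq0.
have [P [Q [Q0 EP ->]]] := relR (R - R').
have T0 : eval_mx kE T (R - R') = 0.
  by rewrite (rmorphB (eval_mx kE T)); apply/eqP; rewrite subr_eq0; apply/eqP.
move: EP; rewrite T0 => /esym/eqP.
rewrite mulf_eq0 invr_eq0 (negPf (Q0F _ Q0)) orbF tofrac_eq0 => /eqP ->.
by rewrite rmorph0 mul0r.
Qed.

End NormalForm.

(** * Invariance and descent along the slice *)

Section SliceInvariance.
Local Open Scope ring_scope.
Variables (E : fieldType) (p q N : nat) (V : 'M[E]_(N, p.+1 + q)) (X : 'M[E]_(N, p.+1)).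
Variables (T : 'M[E]_(q, p.+1)) (lam : 'rV[E]_N) (G : 'M[E]_p.+1).
Hypothesis uG : G \in unitmx.
Hypothesis TE : diag_mx lam *m X *m G = slice V T.

(** Applying [s] to the normal form of [X] and undoing [w] yields another normal form of [X], with
    parameter [map_mx s T], and uniqueness applies. The permutation cancels because [s] permutes the
    rows of [V] in the same way. *)
Lemma slice_param_invariant (s : {rmorphism E -> E}) (w : 'S_N) (mu : 'rV[E]_N) (g : 'M[E]_p.+1) :
  (forall T' lam' G', G' \in unitmx -> diag_mx lam' *m X *m G' = slice V T' -> T' = T) ->
  g \in unitmx -> map_mx s X = row_perm w (diag_mx mu *m X *m g) ->
  map_mx s V = row_perm w V -> map_mx s T = T.
Proof.
move=> uni ug sX sV.
pose lam' : 'rV[E]_N := \row_k (s (lam 0 (w^-1%g k)) * mu 0 k).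
apply: (uni _ lam' (g *m map_mx s G)); first by rewrite unitmx_mul ug map_unitmx.
have row_perm_inj (C D : 'M[E]_(N, p.+1)) : row_perm w C = row_perm w D -> C = D.
  by move=> CD; apply/matrixP => i j; have /matrixP/(_ (w^-1%g i) j) := CD; rewrite !mxE permKV.
apply: row_perm_inj; transitivity (map_mx s (slice V T)); last first.
  by rewrite map_slice sV /slice !row_permE mulmxA.
rewrite -TE !map_mxM map_diag_mx sX !row_permE !mulmxA; congr (_ *m _).
rewrite -!mulmxA; set Y := X *m g.
apply/matrixP => i j; rewrite -!row_permE [diag_mx lam' *m _]mul_diag_mx.
rewrite [diag_mx (map_mx s lam) *m _]mul_diag_mx [diag_mx mu *m _]mul_diag_mx.
by rewrite !mxE permK mulrA.
Qed.

Variables (F Fs : fieldType) (iota : {rmorphism F -> Fs}) (k : {rmorphism Fs -> E}).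
Hypothesis hF : infinite_field F.
Local Notation A := {mpoly Fs[N * p.+1]}.
Local Notation B := {mpoly Fs[q * p.+1]}.
Let j : {rmorphism F -> E} := k \o iota.

Lemma eval_density_mx (R : {mpoly E[p.+1 * p.+1]}) (g : 'M[E]_p.+1) :
  eval_mx (@idfun E : {rmorphism E -> E}) g R != 0 ->
  exists g0 : 'M[F]_p.+1, eval_mx (@idfun E : {rmorphism E -> E}) (map_mx j g0) R != 0.
Proof.
move=> Rg; have [v0 Rv0] := eval_density j hF Rg.
exists (vec_mx (\row_k v0 k)).
suff -> : eval_mx (@idfun E : {rmorphism E -> E}) (map_mx j (vec_mx (\row_k v0 k))) R =
  R.@[fun k => j (v0 k)] by [].
by apply: meval_eq => i; rewrite map_vec_mx vec_mxK !mxE.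
Qed.

(** The value of [R] at [Y *m g] as a polynomial in the entries of [g], the form to which density
    applies. *)
Definition translate (Y : 'M[E]_(N, p.+1)) (R : A) : {mpoly E[p.+1 * p.+1]} :=
  eval_mx ((@mpolyC _ E) \o k) (map_mx (@mpolyC _ E) Y *m gen_points E p.+1 p.+1) R.

Lemma eval_translate (Y : 'M[E]_(N, p.+1)) R (g : 'M[E]_p.+1) :
  eval_mx (@idfun E : {rmorphism E -> E}) g (translate Y R) = eval_mx k (Y *m g) R.
Proof.
rewrite /translate (@rmorph_eval_mx _ _ _ _ k) => [|c]; last by rewrite /= eval_mxC.
rewrite map_mxM map_gen_points_eval; congr (eval_mx _ (_ *m _) _).
by apply/matrixP => i i'; rewrite !mxE /= eval_mxC.
Qed.

Lemma eval_det (g : 'M[E]_p.+1) :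
  eval_mx (@idfun E : {rmorphism E -> E}) g (\det (gen_points E p.+1 p.+1)) = \det g.
Proof. by rewrite -det_map_mx map_gen_points_eval. Qed.

(* Invariance under the rational points of GL_p extends to its [E]-points by density;
   the slice is then reached through [G], up to a translation by a rational matrix
   that keeps the denominator nonzero. *)
Lemma invariant_eval_slice d (P Q : A) : multihomog d P -> multihomog d Q ->
  (forall i, lam 0 i != 0) -> eval_mx k X Q != 0 ->
  (forall g : 'M[Fs]_p.+1, g \in unitmx ->
     eval_mx k (X *m map_mx k g) P * eval_mx k X Q =
     eval_mx k X P * eval_mx k (X *m map_mx k g) Q) ->
  forall VF : 'M[Fs]_(N, p.+1 + q), V = map_mx k VF ->
  exists R S : B, eval_mx k T S != 0 /\
    eval_mx k X P / eval_mx k X Q = eval_mx k T R / eval_mx k T S.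
Proof.
move=> homP homQ lam0 Q0 inv VF VE.
have GLinv (g : 'M[E]_p.+1) : g \in unitmx ->
    eval_mx k (X *m g) P * eval_mx k X Q = eval_mx k X P * eval_mx k (X *m g) Q.
  move=> ug; apply/eqP; rewrite -subr_eq0; apply: contraT => ne.
  (* A failure at some invertible [g] would occur at a matrix over [F] as well; the determinant
     factor keeps that matrix invertible. *)
  pose R : {mpoly E[p.+1 * p.+1]} := (translate X P * (eval_mx k X Q)%:MP -
    (eval_mx k X P)%:MP * translate X Q) * \det (gen_points E p.+1 p.+1).
  have RE (g' : 'M[E]_p.+1) : eval_mx (@idfun E : {rmorphism E -> E}) g' R =
      (eval_mx k (X *m g') P * eval_mx k X Q - eval_mx k X P * eval_mx k (X *m g') Q) * \det g'.
    by rewrite /R rmorphM rmorphB !rmorphM /= !eval_translate eval_det !eval_mxC.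
  have [|g0] := @eval_density_mx R g.
    by rewrite RE mulf_neq0 // -unitfE -unitmxE.
  rewrite RE mulf_eq0 negb_or => /andP [/negP ne0 det0]; case: ne0.
  rewrite subr_eq0 /j map_mx_comp inv // -(map_unitmx k) -map_mx_comp.
  by rewrite unitmxE unitfE.
(* [invmx G] leads back to [X], where [Q] is nonzero; density replaces it by a matrix over [F], so
   that [Y] below has its entries in [B]. *)
have [g0 [Qg0 ug0]] : exists g0 : 'M[F]_p.+1,
    eval_mx k (X *m G *m map_mx j g0) Q != 0 /\ map_mx j g0 \in unitmx.
  pose R := translate (X *m G) Q * \det (gen_points E p.+1 p.+1).
  have RE (g' : 'M[E]_p.+1) : eval_mx (@idfun E : {rmorphism E -> E}) g' R =
      eval_mx k (X *m G *m g') Q * \det g'.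
    by rewrite /R rmorphM /= eval_translate eval_det.
  have [|g0] := @eval_density_mx R (invmx G).
    by rewrite RE mulmxK // mulf_neq0 // -unitfE -unitmxE unitmx_inv.
  rewrite RE mulf_eq0 negb_or => /andP [Qg0 det0].
  by exists g0; rewrite unitmxE unitfE.
pose g0B : 'M[B]_p.+1 := map_mx (@mpolyC _ _ \o iota) g0.
pose Y : 'M[B]_(N, p.+1) := slice (map_mx (@mpolyC _ _) VF) (gen_points Fs q p.+1) *m g0B.
have TY : map_mx (eval_mx k T) Y = diag_mx lam *m (X *m G *m map_mx j g0).
  rewrite map_mxM map_slice map_gen_points_eval !mulmxA TE; congr (slice _ _ *m _).
    by rewrite VE; apply/matrixP => i i'; rewrite !mxE /= eval_mxC.
  by apply/matrixP => i i'; rewrite !mxE /= eval_mxC.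
have evY R : multihomog d R -> eval_mx k T (eval_mx (@mpolyC _ Fs) Y R) =
    (\prod_i lam 0 i ^+ d i) * eval_mx k (X *m G *m map_mx j g0) R.
  move=> homR; rewrite (@rmorph_eval_mx _ _ _ _ k) => [|c]; last by rewrite /= eval_mxC.
  by rewrite TY (eval_multihomog _ _ _ homR).
have w0 : \prod_i lam 0 i ^+ d i != 0.
  by apply/prodf_neq0 => i _; rewrite expf_neq0.
(* [P] and [Q] have the same multidegree, so the factor due to [lam] cancels. *)
exists (eval_mx (@mpolyC _ Fs) Y P), (eval_mx (@mpolyC _ Fs) Y Q).
rewrite !evY // mulf_neq0 //; split=> //.
rewrite -mulf_div divff // mul1r; apply/eqP; rewrite eqr_div //.
by rewrite -mulmxA -GLinv ?unitmx_mul ?uG // mulrC.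
Qed.

(* Artin's argument: a denominator of minimal support with a coefficient 1 is fixed by
   every [sa i], since otherwise its difference with its conjugate has smaller support. *)
Lemma funfield_descent (I : Type) (sa : I -> {rmorphism Fs -> Fs}) f :
  injective (eval_mx k T : B -> E) ->
  (forall c, (forall i, sa i c = c) -> exists b, c = iota b) ->
  (forall i, exists s : {rmorphism E -> E},
     [/\ s f = f, map_mx s T = T & forall c, s (k c) = k (sa i c)]) ->
  (exists R S : B, eval_mx k T S != 0 /\ f = eval_mx k T R / eval_mx k T S) ->
  exists R S : {mpoly F[q * p.+1]}, S != 0 /\
    f = eval_mx k T (map_mpoly iota R) / eval_mx k T (map_mpoly iota S).
Proof.
move=> Tinj fixF sigma [R0 [S0 [S00 fE0]]].
pose ann n := `[< exists R S : B, [/\ S != 0, f * eval_mx k T S = eval_mx k T R &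
  size (msupp S) = n] >].
have ex_ann : exists n, ann n.
  exists (size (msupp S0)); apply/asboolP; exists R0, S0; split=> //.
    by apply: contraNneq S00 => ->; rewrite rmorph0.
  by rewrite fE0 divfK.
case: (ex_minnP ex_ann) => n /asboolP [R1 [S1 [S10 fS1 sS1]]] min_n.
have [mon0 Smon0] : exists mon0, mon0 \in msupp S1.
  case Es : (msupp S1) => [|mon0 s]; last by exists mon0; rewrite mem_head.
  by move/eqP: Es; rewrite msupp_eq0 (negPf S10).
pose c := S1@_mon0; have c0 : c != 0 by rewrite -mcoeff_msupp.
pose S := c^-1 *: S1; pose R := c^-1 *: R1.
have evZ (b : Fs) (W : B) : eval_mx k T (b *: W) = k b * eval_mx k T W.
  by rewrite -mul_mpolyC rmorphM /= eval_mxC.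
have fS : f * eval_mx k T S = eval_mx k T R by rewrite !evZ mulrCA fS1.
have ev0 (W : B) : eval_mx k T W = 0 -> W = 0.
  by move=> W0; apply: Tinj; rewrite W0 rmorph0.
have fixRS i : map_mpoly (sa i) S = S /\ map_mpoly (sa i) R = R.
  have [s [sf sT sk]] := sigma i.
  (* As [s] fixes [T], it acts on a polynomial in [T] through the coefficients alone. *)
  have ev_s (W : B) : s (eval_mx k T W) = eval_mx k T (map_mpoly (sa i) W).
    have -> : s (eval_mx k T W) = eval_mx (k \o sa i) T W.
      by rewrite (@rmorph_eval_mx _ _ _ _ (k \o sa i)) ?sT.
    symmetry; apply: (@eval_mx_unique _ _ _ _ (eval_mx k T \o map_mpoly (sa i))) => [b|].
      by rewrite /= map_mpolyC eval_mxC.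
    by apply/matrixP => a b; rewrite !mxE /= map_mpolyX eval_mxX.
  pose S' := map_mpoly (sa i) S - S; pose R' := map_mpoly (sa i) R - R.
  have fS' : f * eval_mx k T S' = eval_mx k T R'.
    rewrite /S' /R' !rmorphB /= -!ev_s mulrBr fS -fS rmorphM /= sf.
    by rewrite fS.
  have S'0 : S' = 0.
    apply/eqP; apply: contraT => S'0.
    have : (n <= size (msupp S'))%N by apply/min_n/asboolP; exists R', S'.
    rewrite leqNgt -sS1 (perm_size (perm_to_rem Smon0)) /= ltnS.
    case/negP; apply: uniq_leq_size => [|mon]; first exact: msupp_uniq.
    rewrite mem_rem_uniq ?msupp_uniq // inE !mcoeff_msupp /S' mcoeffB.
    rewrite mcoeff_map_mpoly /= mcoeffZ => ne; apply/andP; split.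
      apply: contraNneq ne => ->.
      by rewrite -/c mulVf // rmorph1 subrr.
    by apply: contraNneq ne => ->; rewrite mulr0 rmorph0 subrr.
  have R'0 : R' = 0 by apply: ev0; rewrite -fS' S'0 rmorph0 mulr0.
  by split; apply/eqP; rewrite -subr_eq0; apply/eqP.
have descend (W : B) : (forall i, map_mpoly (sa i) W = W) ->
    exists W0 : {mpoly F[q * p.+1]}, W = map_mpoly iota W0.
  move=> fixW.
  have coefW mon : exists b, W@_mon = iota b.
    by apply: fixF => i; rewrite -mcoeff_map_mpoly fixW.
  rewrite [W]mpolyE; elim/big_ind: _ => [|U1 U2 [W1 ->] [W2 ->]|mon _].
  - by exists 0; rewrite rmorph0.
  - by exists (W1 + W2); rewrite rmorphD.
  - have [b ->] := coefW mon; exists (b *: 'X_[mon]).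
    by rewrite -!mul_mpolyC rmorphM /= map_mpolyC map_mpolyX.
have [R2 R2E] := descend R (fun i => (fixRS i).2).
have [S2 S2E] := descend S (fun i => (fixRS i).1).
have S0' : S != 0 by rewrite /S -mul_mpolyC mulf_neq0 // mpolyC_eq0 invr_eq0.
exists R2, S2; split.
  by apply: contraNneq S0' => S20; rewrite S2E S20 rmorph0.
rewrite -R2E -S2E -fS mulfK //.
by apply: contraNneq S0' => /ev0 ->.
Qed.

End SliceInvariance.

(** * The twisted function field *)

Section TwistedModuli.
Local Open Scope ring_scope.
Local Notation "x %:F" := (@FracField.tofrac _ x).
Variables (F Fs : fieldType) (iota : {rmorphism F -> Fs}) (N p q : nat).
Variables (eps : 'I_(p.+1 + q) -> nat) (a : 'rV[Fs]_N).

Local Notation A := {mpoly Fs[N * p.+1]}.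
Local Notation E := {fraction A}.
Local Notation kE := (const_fracs Fs (N * p.+1)).
Local Notation XE := (gen_points_frac Fs p N).
Local Notation VE := (map_mx kE (power_mx eps a)).

Variables (T : 'M[E]_(q, p.+1)) (lam : 'rV[E]_N) (G : 'M[E]_p.+1).
Hypotheses (lam0 : forall i, lam 0 i != 0) (uG : G \in unitmx).
Hypothesis TE : diag_mx lam *m XE *m G = slice VE T.
Hypothesis uniT : forall T' lam' G', G' \in unitmx ->
  diag_mx lam' *m XE *m G' = slice VE T' -> T' = T.
Hypothesis Tinj : injective (eval_mx kE T : {mpoly Fs[q * p.+1]} -> E).

(** The twisted Galois action, [GL_p] and the rescalings all send the generic configuration to a
    rescaled, translated and permuted copy of itself; this treats the three at once. *)
Lemma frac_map_param (h : {rmorphism A -> A}) (s : {rmorphism Fs -> Fs}) (w : 'S_N)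
    (mu : 'rV[Fs]_N) (g : 'M[Fs]_p.+1) :
  injective h -> (forall c, h c%:MP = (s c)%:MP) -> g \in unitmx ->
  map_mx h (gen_points Fs N p.+1) = row_perm w (diag_mx (map_mx (@mpolyC _ _) mu) *m
    gen_points Fs N p.+1 *m map_mx (@mpolyC _ _) g) ->
  (forall i, s (a 0 i) = a 0 (w i)) ->
  exists sigma : {rmorphism E -> E}, [/\ sigma =1 frac_map h, map_mx sigma T = T &
    forall c, sigma (kE c) = kE (s c)].
Proof.
move=> hI hC ug hX sa; have [sigma sigmaE sigmaP] := frac_map_rmorph hI.
have sigmaC c : sigma (kE c) = kE (s c) by rewrite sigmaP hC.
exists sigma; split=> //.
have ugE : map_mx kE g \in unitmx by rewrite map_unitmx.
apply: (slice_param_invariant uG TE uniT ugE (s := sigma) (w := w) (mu := map_mx kE mu)).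
  have -> : map_mx sigma XE = map_mx (@FracField.tofrac _) (map_mx h (gen_points Fs N p.+1)).
    by apply/matrixP => i j; rewrite !mxE sigmaP.
  by rewrite hX map_row_perm !map_mxM map_diag_mx -!map_mx_comp.
apply/matrixP => i j; rewrite !mxE sigmaC; congr (kE _).
by rewrite rmorphXn sa.
Qed.

Lemma proj_moduli_slice f : infinite_field F -> moduli_funfield f ->
  exists R S : {mpoly Fs[q * p.+1]}, eval_mx kE T S != 0 /\
    f = eval_mx kE T R / eval_mx kE T S.
Proof.
move=> hF [[d [P [Q [homP homQ Q0 fE]]]] finv].
have evE R : eval_mx kE XE R = R%:F by apply: eval_gen_points_frac.
have Q0' : eval_mx kE XE Q != 0 by rewrite evE tofrac_eq0.
have inv (g : 'M[Fs]_p.+1) : g \in unitmx ->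
    eval_mx kE (XE *m map_mx kE g) P * eval_mx kE XE Q =
    eval_mx kE XE P * eval_mx kE (XE *m map_mx kE g) Q.
  move=> ug.
  have glE R : eval_mx kE (XE *m map_mx kE g) R = (gl_subst g R)%:F.
    rewrite /gl_subst /subst_points -/(eval_mx _ _ _) (@rmorph_eval_mx _ _ _ _ kE) //.
    by rewrite map_mxM -map_mx_comp.
  have gQ0 : (gl_subst g Q)%:F != 0.
    by rewrite tofrac_eq0 -(rmorph0 (gl_subst g)) (inj_eq (gl_subst_inj ug)).
  have Q0F : Q%:F != 0 by rewrite tofrac_eq0.
  have := finv g ug; rewrite fE (frac_mapE _ (gl_subst_inj ug) Q0) => /eqP.
  by rewrite (eqr_div _ _ gQ0 Q0F) !glE !evE => /eqP.
have [R [S [S0 RS]]] := invariant_eval_slice uG TE iota hF homP homQ lam0 Q0' inv (erefl VE).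
by exists R, S; split=> //; rewrite fE -RS !evE.
Qed.

Variable rho : gal_aut iota -> 'S_N.
Hypotheses (hF : infinite_field F) (hFs : separable_closure iota).
Hypothesis a_equiv : forall (s : gal_aut iota) i, s (a 0 i) = a 0 (rho s i).

Lemma twist_param (s : gal_aut iota) : exists sigma : {rmorphism E -> E},
  [/\ sigma =1 frac_map (twist_subst s (rho s)), map_mx sigma T = T &
      forall c, sigma (kE c) = kE (s c)].
Proof.
apply: (@frac_map_param (twist_subst s (rho s)) s (rho s) (const_mx 1) 1%:M).
- exact: twist_subst_inj.
- exact: twist_substC.
- exact: unitmx1.
- rewrite map_const_mx rmorph1 diag_const_mx mul1mx map_mx1 mulmx1.
  by apply/matrixP => i j; rewrite !mxE /= twist_substX.
- exact: a_equiv.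
Qed.

Lemma gl_param (g : 'M[Fs]_p.+1) : g \in unitmx -> exists sigma : {rmorphism E -> E},
  [/\ sigma =1 frac_map (gl_subst g), map_mx sigma T = T & forall c, sigma (kE c) = kE c].
Proof.
move=> ug.
pose id_Fs : {rmorphism Fs -> Fs} := @idfun Fs.
apply: (@frac_map_param (gl_subst g) id_Fs 1%g (const_mx 1) g).
- exact: gl_subst_inj.
- exact: gl_substC.
- exact: ug.
- rewrite map_const_mx rmorph1 diag_const_mx mul1mx row_perm1.
  exact: map_gen_points_eval.
- by move=> i; rewrite perm1.
Qed.

(** Used to show that rational functions of [T] are quotients of multihomogeneous polynomials of
    equal multidegree. *)
Lemma scale_param (mu : 'rV[Fs]_N) : (forall i, mu 0 i != 0) ->
  exists sigma : {rmorphism E -> E},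
  [/\ sigma =1 frac_map (scale_subst mu), map_mx sigma T = T & forall c, sigma (kE c) = kE c].
Proof.
move=> mu0.
pose id_Fs : {rmorphism Fs -> Fs} := @idfun Fs.
apply: (@frac_map_param (scale_subst mu) id_Fs 1%g mu 1%:M).
- exact: scale_subst_inj.
- by move=> c; apply: eval_mxC.
- exact: unitmx1.
- rewrite map_mx1 mulmx1 row_perm1.
  exact: map_gen_points_eval.
- by move=> i; rewrite perm1.
Qed.

Lemma twisted_moduli_rational :
  rational_funfield (const_frac iota (N * p.+1)) (@twisted_moduli_funfield F Fs iota N p.+1 rho).
Proof.
pose C := {mpoly F[q * p.+1]}.
pose h : {rmorphism C -> E} := eval_mx kE T \o map_mpoly iota.
have hI : injective h.
  move=> P Q /Tinj /mpolyP PQ; apply/mpolyP => mon; have := PQ mon.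
  by rewrite !mcoeff_map_mpoly; apply: fmorph_inj.
have [phi phiE] := frac_lift hI.
have phi1 P : phi P%:F = h P.
  by rewrite -[P%:F]divr1 -tofrac1 phiE ?oner_eq0 // rmorph1 divr1.
exists (q * p.+1)%N, phi; split=> [c|f].
  by rewrite phi1 /h /= map_mpolyC eval_mxC.
(* An invariant [f] is a rational function of [T] over [Fs]; as the Galois action fixes both [f] and
   [T], its coefficients descend to [F]. *)
split=> [[mod_f gal_f]|[g ->{f}]].
  pose sa (s : gal_aut iota) : {rmorphism Fs -> Fs} := s.
  have fixF c : (forall s, sa s c = c) -> exists b, c = iota b by apply: gal_fixed_field.
  have sigmas s : exists sigma : {rmorphism E -> E},
      [/\ sigma f = f, map_mx sigma T = T & forall c, sigma (kE c) = kE (sa s c)].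
    have [sigma [sigmaE sigmaT sigmaC]] := twist_param s.
    by exists sigma; split; [rewrite sigmaE gal_f|exact: sigmaT|exact: sigmaC].
  have [R [S [S0 ->]]] := funfield_descent Tinj fixF sigmas (proj_moduli_slice hF mod_f).
  by exists (R%:F / S%:F); rewrite phiE.
(* Conversely, a morphism that fixes [T] and the constants from [F] fixes the whole image of [phi];
   all three actions are of this kind. *)
have phi_fix (sigma : {rmorphism E -> E}) : map_mx sigma T = T ->
    (forall c, sigma (kE (iota c)) = kE (iota c)) -> sigma (phi g) = phi g.
  move=> sigmaT sigmaC.
  have h_fix P : sigma (h P) = h P.
    apply: (@mpoly_rmorph_eq _ _ _ (sigma \o h) h) => [c|k].
      by rewrite /h /= map_mpolyC eval_mxC sigmaC.
    case/mxvec_indexP: k => i j; rewrite /h /= map_mpolyX eval_mxX.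
    by rewrite -{2}sigmaT mxE.
  have [P [Q [Q0 ->]]] := fracP g.
  by rewrite phiE // fmorph_div !h_fix.
split; first split.
- apply: (proj_funfield_scale_invariant iota hF) => mu mu0.
  by have [sigma [<- sigmaT sigmaC]] := scale_param mu0; apply: phi_fix.
- by move=> g' ug'; have [sigma [<- sigmaT sigmaC]] := gl_param ug'; apply: phi_fix.
- move=> s; have [sigma [<- sigmaT sigmaC]] := twist_param s; apply: phi_fix => // c.
  by rewrite sigmaC gal_fix.
Qed.

End TwistedModuli.

Theorem corollary16 (m p : nat) (hm : 1 <= m) (hp : 2 <= p)
    (F : fieldType) (hF : infinite_field F)
    (Fs : fieldType) (iota : {rmorphism F -> Fs})
    (hFs : separable_closure iota)
    (rho : gal_aut iota -> 'S_(p * m + 1))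
    (hrho : gal_hom rho) (crho : krull_continuous rho) :
  rational_funfield (const_frac iota ((p * m + 1) * p))
    (@twisted_moduli_funfield F Fs iota (p * m + 1) p rho).
Proof.
case: p hp rho hrho crho => // p _ rho hrho crho.
have [q [eps [Er eps_inj eps_lt eps_l]]] := exponent_arrangement p hm.
have [a [a_inj a_equiv]] := equivariant_points hFs hF hrho crho.
pose v : 'rV[Fs]_(p.+1 * m + 1) := (\row_i a i)%R.
have v_inj : injective (v 0%R) by move=> i j; rewrite !mxE => /a_inj.
have v_equiv (s : gal_aut iota) i : s (v 0%R i) = v 0%R (rho s i) by rewrite !mxE a_equiv.
have [T [lam [G [lam0 uG TE uniT Tinj]]]] :=
  slice_normal_form eps_inj eps_lt eps_l erefl Er v_inj.
exact: (twisted_moduli_rational lam0 uG TE uniT Tinj hF hFs v_equiv).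
Qed.
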